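(* Let $0<a\le1$, $H=T^a$, $\alpha>0$, and let $f$ be a real-valued even function with $\hat f\in C_c^\infty(\mathbb{R})$ and $\operatorname{supp}\hat f\subset(-\alpha,\alpha)$. Let $w\ge0$ with $\int w=1$ and $\hat w$ compactly supported. Then for every integer $m$ with $2\le m<2a/\alpha$, as $T\to\infty$, $$\langle (N_f^{\mathrm{osc}})^m\rangle_{T,H}=\begin{cases}\dfrac{(2k)!}{k!\,2^k}\sigma_f^{2k}, & m=2k,\\[4pt] 0, & m=2k+1,\end{cases}\;+\;O\Big(\frac1{\log T}\Big),$$ where $\sigma_f^2=\int_{-\infty}^\infty\min(|u|,1)\,\hat f(u)^2\,du$.
   Context: $\hat f(u)=\int f(x)e^{-2\pi ixu}\,dx$. $\Lambda$ is the von Mangoldt function. For real $\tau$, $$N_f^{\mathrm{osc}}(\tau)=-\frac{1}{\log T}\sum_{n\ge2}\frac{\Lambda(n)}{\sqrt n}\hat f\Big(\frac{\log n}{\log T}\Big)\big(e^{i\tau\log n}+e^{-i\tau\log n}\big).$$ For a function $W$ of $\tau$, $\langle W\rangle_{T,H}=\int_{-\infty}^\infty W(\tau)w\big(\frac{\tau-T}{H}\big)\frac{d\tau}{H}$. *)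

(* Defs.v *)
From HB Require Import structures.
From mathcomp Require Import all_boot all_order all_algebra.
From mathcomp Require Import all_classical all_reals all_analysis.
Set Implicit Arguments. Unset Strict Implicit. Unset Printing Implicit Defensive.
Import Order.TTheory GRing.Theory Num.Theory.
Import numFieldNormedType.Exports.
Local Open Scope classical_set_scope.
Local Open Scope ring_scope.

Section Defs.
Variable R : realType.

Definition intR (g : R -> R) : R := Rintegral (@lebesgue_measure R) setT g.

Definition Lint (g : R -> R) : Prop :=
  (@lebesgue_measure R).-integrable setT (EFin \o g).

(* Fourier transform  \hat g(u) = \int g(x) e^{-2 pi i x u} dx,
   split into real and imaginary parts. *)
Definition ft_re (g : R -> R) (u : R) : R := intR (fun x => g x * cos (2 * pi * x * u)).
Definition ft_im (g : R -> R) (u : R) : R := - intR (fun x => g x * sin (2 * pi * x * u)).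

Definition vonMangoldt (n : nat) : R :=
  if (1 < n)%N && (size (primes n) == 1)%N then ln (pdiv n)%:R else 0.

Definition smooth (g : R -> R) : Prop :=
  forall (n : nat) (x : R), derivable (derive1n n g) x 1.

(* N_f^osc(tau); here e^{i tau log n} + e^{-i tau log n} = 2 cos(tau log n),
   and \hat f = ft_re f since f is real and even (ft_im f = 0). *)
Definition Nosc (f : R -> R) (T tau : R) : R :=
  - (ln T)^-1 * limn (fun N => \sum_(2 <= n < N)
      (vonMangoldt n / Num.sqrt (n%:R) * ft_re f (ln (n%:R) / ln T)
        * (2 * cos (tau * ln (n%:R))))).

Definition avg (w W : R -> R) (T H : R) : R :=
  intR (fun tau => W tau * w ((tau - T) / H) / H).

Definition sigma2 (f : R -> R) : R :=
  intR (fun u => Num.min `|u| 1 * (ft_re f u) ^+ 2).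

Definition gauss_moment (m : nat) (s2 : R) : R :=
  if odd m then 0
  else ((m`!)%:R / (((m./2)`!)%:R * 2 ^+ m./2)) * s2 ^+ m./2.

End Defs.

(* Main.v *)
Require Import Defs.
From HB Require Import structures.
From mathcomp Require Import all_boot all_order all_algebra.
From mathcomp Require Import all_classical all_reals all_analysis.
From mathcomp Require Import measurable_realfun.
From mathcomp Require Import zify ring lra.
Import Order.TTheory GRing.Theory Num.Theory.
Import numFieldNormedType.Exports.
Local Open Scope classical_set_scope.
Local Open Scope ring_scope.
Set Implicit Arguments.
Unset Strict Implicit.
Unset Printing Implicit Defensive.

(* Grouping prime powers by their prime, [N_f^osc = sum_p Y_p] where [Y_p] is a
   trigonometric polynomial with frequencies in [Z ln p].  Every frequency of the
   [m]-th power is [ln (P / Q)] with [P * Q <= T ^ (c * m)], [c < alpha], so a nonzero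
   one is at least [T ^ (- c * m / 2) / 2]; as [c * m / 2 < a], the compact support
   of the Fourier transform of [w] kills it once [T] is large.  The average then only
   sees the frequency [0], and unique factorization makes the [Y_p] behave exactly
   like independent centered random variables.

   Adding the primes one at a time, the [m]-th moment of the partial sum obeys the
   recursion of the Gaussian moments up to an error [O (b_p ^ 3)], where
   [|Y_p| <= b_p = O (ln p / (sqrt p * ln T))]; Mertens' first theorem gives
   [sum_p b_p ^ 3 = O (1 / ln T)].  Finally the total variance is
   [(2 / L) * sum_p (ln p / p) * phi (ln p / L) + O (1 / L)] with [L = ln T] and
   [phi u = u * (ft_re f u) ^ 2], and Abel summation against Mertens' theorem turns it
   into [sigma2 f + O (1 / L)]; the truncation [min (|u|, 1)] is harmless since
   [m >= 2] forces [alpha < 1]. *)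

(** * Mertens' first theorem *)

Section PrimeSums.
Variable R : realType.
Implicit Types n p k : nat.

Lemma ln_nat_ge0 n : 0 <= ln n%:R :> R.
Proof. by case: n => [|n]; [rewrite ln0 | rewrite ln_ge0// ler1n]. Qed.

Lemma ln_ge1BV (x : R) : 0 < x -> 1 - x^-1 <= ln x.
Proof.
move=> x0; have : ln x^-1 <= x^-1 - 1.
  have := @le_ln1Dx R (x^-1 - 1); rewrite [1 + _]addrC subrK; apply.
  by rewrite ltrBrDr addNr invr_gt0.
by rewrite lnV ?posrE// => h; lra.
Qed.

Lemma lnS_le n : (0 < n)%N -> ln n.+1%:R - ln n%:R <= n%:R^-1 :> R.
Proof.
move=> n0; have n0' : 0 < n%:R :> R by rewrite ltr0n.
rewrite -ln_div ?posrE ?ltr0n// -[n.+1]addn1 natrD mulrDl divff ?gt_eqF// mul1r.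
by apply: le_ln1Dx; apply: (@lt_trans _ _ 0); rewrite ?invr_gt0// ltrN10.
Qed.

Lemma lnS_ge n : (0 < n)%N -> n.+1%:R^-1 <= ln n.+1%:R - ln n%:R :> R.
Proof.
move=> n0; have n0' : 0 < n%:R :> R by rewrite ltr0n.
rewrite -ln_div ?posrE ?ltr0n//.
have := @ln_ge1BV (n.+1%:R / n%:R); rewrite divr_gt0 ?ltr0n// => /(_ isT).
apply: le_trans; rewrite invf_div -[n.+1]addn1 natrD.
by rewrite -{3}(@divff _ (n%:R + 1)) -?mulrBl ?(addrAC _ 1) ?subrr ?add0r ?div1r// gt_eqF// ltr_wpDr.
Qed.

(** A weak Stirling bound: the induction step amounts to [n * (ln (n + 1) - ln n) <= 1]. *)
Lemma ln_fact_lb n : n%:R * ln n%:R - n%:R <= ln n`!%:R :> R.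
Proof.
elim: n => [|n IHn]; first by rewrite fact0 ln1 mul0r subr0.
case: (posnP n) => [->|n0]; first by rewrite (_ : 1`! = 1%N)// ln1 mulr0 sub0r lerNl oppr0.
rewrite factS natrM lnM ?posrE ?ltr0n ?fact_gt0//.
have := lnS_le n0; rewrite -(ler_pM2l (x := n%:R)) ?ltr0n// divff ?pnatr_eq0 -?lt0n//.
by move: IHn; rewrite -[n.+1%:R]natr1; nra.
Qed.

Lemma ln_fact_ub n : ln n`!%:R <= n%:R * ln n%:R :> R.
Proof.
elim: n => [|n IHn]; first by rewrite fact0 ln1 mul0r.
rewrite factS natrM lnM ?posrE ?ltr0n ?fact_gt0//.
have -> : n.+1%:R * ln n.+1%:R = ln n.+1%:R + n%:R * ln n.+1%:R :> R.
  by move: (ln n.+1%:R) => l; rewrite -natr1; ring.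
rewrite lerD2l.
apply: (le_trans IHn); apply: ler_wpM2l => //.
case: (posnP n) => [->|n0]; first by rewrite ln0// ln1.
by rewrite ler_ln ?posrE ?ltr0n// ler_nat.
Qed.

Lemma logn0l n : logn 0 n = 0%N.
Proof. by rewrite lognE. Qed.

(** Unique factorization in logarithmic form. The cut-off [m] is free above [n], so that sums
    attached to different integers can share one range. *)
Lemma ln_prime_factors n m : (0 < n)%N -> (n <= m)%N ->
  ln n%:R = \sum_(0 <= p < m.+1 | prime p) (logn p n)%:R * ln p%:R :> R.
Proof.
move=> n0 nm; rewrite -[in LHS](partnT n0) (widen_partn _ nm).
have h (s : seq nat) :
    ln (\prod_(p <- s | p \in predT) p ^ logn p n)%N%:R =
    \sum_(p <- s) (logn p n)%:R * ln p%:R :> R.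
  elim: s => [|p s IHs]; first by rewrite !big_nil ln1.
  rewrite !big_cons /= natrM lnM ?IHs ?posrE; last 2 first.
  - by rewrite ltr0n expn_gt0; case: posnP => // ->; rewrite logn0l eqxx orbT.
  - by rewrite ltr0n prodn_cond_gt0// => q _; rewrite expn_gt0; case: posnP => // ->; rewrite logn0l eqxx orbT.
  congr (_ + _); case: (posnP p) => [->|p0].
    by rewrite logn0l expn0 ln1 mul0r.
  by rewrite natrX lnXn ?ltr0n// mulr_natl.
rewrite h [RHS]big_mkcond/=; apply: eq_bigr => p _; case: ifPn => // pp.
by rewrite lognE (negbTE pp) mul0r.
Qed.

Lemma Euclid_dvd_fact n p : prime p -> (p %| n`!)%N = (p <= n)%N.
Proof.
move=> pp; elim: n => [|n IHn].
  by rewrite fact0 Euclid_dvd1//; case: p pp.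
rewrite factS Euclid_dvdM// IHn [RHS]leq_eqVlt [in RHS]ltnS.
case: (leqP p n) => np; rewrite ?orbT// !orbF; apply/idP/eqP => [/(dvdn_leq (ltn0Sn n))|->//].
by rewrite leq_eqVlt ltnS leqNgt np orbF => /eqP.
Qed.

Definition theta n : R := \sum_(0 <= p < n.+1 | prime p) ln p%:R.

(** Chebyshev's argument: a prime in [(k + 1, 2k + 1]] divides [(2k + 1)!] but neither [k!] nor
    [(k + 1)!], hence it divides the binomial coefficient. *)
Lemma theta_odd k : theta k.*2.+1 <= theta k.+1 + ln 'C(k.*2.+1, k)%:R.
Proof.
have C0 : (0 < 'C(k.*2.+1, k))%N by rewrite bin_gt0 -addnn; lia.
set m := maxn 'C(k.*2.+1, k) k.*2.+1.
rewrite (@ln_prime_factors _ m) ?leq_maxl// /theta.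
have -> : \sum_(0 <= p < k.+2 | prime p) ln p%:R =
  \sum_(0 <= p < m.+1 | prime p) (p < k.+2)%:R * ln p%:R :> R.
  rewrite (big_nat_widen _ _ m.+1) /=; last by rewrite ltnS /m leq_max; apply/orP; right; lia.
  by rewrite big_mkcondr/=; apply: eq_bigr => p _; case: ifP; rewrite ?mul1r ?mul0r.
rewrite -big_split/= (big_nat_widen _ _ m.+1) /=; last by rewrite ltnS leq_maxr.
rewrite big_mkcondr/= ler_sum// => p pp.
case: ifPn => [pk|_]; last by rewrite addr_ge0// mulr_ge0// ln_nat_ge0.
rewrite -mulrDl -[leLHS]mul1r ler_wpM2r ?ln_nat_ge0// -natrD ler1n.
case: (ltnP p k.+2) => // kp.
suff h : (0 < logn p 'C(k.*2.+1, k))%N by rewrite addn_gt0 h orbT.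
rewrite -pfactor_dvdn// expn1 -addnn.
have := @bin_fact (k + k).+1 k => /(_ ltac:(lia)).
have -> : ((k + k).+1 - k = k.+1)%N by lia.
have : (p %| (k + k).+1`!)%N by apply: dvdn_fact; rewrite prime_gt0 //= addnn -ltnS.
move=> + e; rewrite -e Euclid_dvdM// Euclid_dvdM// => /orP[//|].
rewrite (Euclid_dvd_fact k pp) (Euclid_dvd_fact k.+1 pp) [(p <= k)%N]leqNgt (ltnW kp).
by rewrite leqNgt kp.
Qed.

(** The coefficients at [k] and [k + 1] of row [2k + 1] are equal, and together they are at most the
    row sum [2 ^ (2k + 1)]. *)
Lemma bin_odd_le k : ('C(k.*2.+1, k) <= 4 ^ k)%N.
Proof.
have : (2 ^ k.*2.+1 = \sum_(i < k.*2.+2) 'C(k.*2.+1, i))%N.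
  by rewrite -[2%N]/(1 + 1)%N expnDn; apply: eq_bigr => i _; rewrite !exp1n !muln1.
move=> h; have : ('C(k.*2.+1, k) + 'C(k.*2.+1, k) <= 2 ^ k.*2.+1)%N.
  have kk : (k < k.*2.+2)%N by rewrite -addnn; lia.
  have kk1 : (k.+1 < k.*2.+2)%N by rewrite -addnn; lia.
  rewrite h (bigD1 (Ordinal kk))//= (bigD1 (Ordinal kk1))//=; last first.
    by rewrite -val_eqE /= gtn_eqF.
  have -> : 'C(k.*2.+1, k.+1) = 'C(k.*2.+1, k).
    rewrite -[in RHS]bin_sub; last by rewrite -addnn; lia.
    by congr 'C(_, _); rewrite -addnn; lia.
  by rewrite addnA leq_addr.
rewrite expnS -addnn expnD -expnMn (_ : (2 * 2)%N = 4%N)//; lia.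
Qed.

(** Strong induction: an even [n > 2] is not prime, so [theta] is constant there; for odd
    [n = 2k + 1] the bounds [(k + 1) ln 4] and [k ln 4] add up to exactly [n ln 4]. *)
Lemma theta_le n : theta n <= n%:R * ln 4.
Proof.
have l4 : 0 <= ln 4 :> R by rewrite ln_ge0// ler1n.
elim/ltn_ind: n => n IHn.
have recl j : theta j.+1 = theta j + (if prime j.+1 then ln j.+1%:R else 0).
  by rewrite /theta [LHS]big_mkcond big_nat_recr//= -big_mkcond.
case: (leqP n 2) => [n2|n2].
  case: n n2 IHn => [|[|[|]]]// _ _; rewrite ?recl /=.
  - by rewrite /theta big_mkcond big_nat_recr//= big_geq// mul0r addr0.
  - by rewrite /theta big_mkcond big_nat_recr//= big_geq// mul1r !addr0.
  - rewrite /theta big_mkcond big_nat_recr//= big_geq// !(addr0,add0r).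
    have : ln 2 <= ln 4 :> R by rewrite ler_ln ?posrE ?ltr0n ?ler_nat//.
    lra.
have [on|en] := boolP (odd n); last first.
  have [j jn] : exists j, n = j.+1 by exists n.-1; lia.
  rewrite jn recl ifF ?addr0; last first.
    apply/negbTE/negP => pj; have := even_prime pj.
    by rewrite -jn (negbTE en); lia.
  apply: (le_trans (IHn j ltac:(lia))).
  by rewrite ler_wpM2r// ler_nat.
have [k nk] : exists k, n = k.*2.+1.
  by exists n./2; rewrite -[LHS]odd_double_half on.
rewrite nk; apply: (le_trans (theta_odd k)).
have := IHn k.+1 ltac:(rewrite nk -addnn in n2 *; lia).
have : ln 'C(k.*2.+1, k)%:R <= k%:R * ln 4 :> R.
  rewrite mulr_natl -lnXn ?ltr0n// -natrX ler_ln ?posrE ?ltr0n ?expn_gt0// ?ler_nat ?bin_odd_le//.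
  by rewrite bin_gt0 -addnn; lia.
have -> : k.*2.+1%:R = k.+1%:R + k%:R :> R by rewrite -natrD -addnn; congr _%:R; lia.
rewrite mulrDl; lra.
Qed.

Lemma ln_fact_primes n :
  ln n`!%:R = \sum_(0 <= p < n.+1 | prime p) (logn p n`!)%:R * ln p%:R :> R.
Proof.
rewrite (@ln_prime_factors n`! n`!) ?fact_gt0//.
have nn : (n.+1 <= n`!.+1)%N by rewrite ltnS fact_geq.
rewrite (big_cat_nat (leq0n _) nn)//= [X in _ + X]big_nat_cond [X in _ + X]big1 ?addr0//.
move=> p /andP[/andP[np _] pp].
by rewrite lognE pp fact_gt0 Euclid_dvd_fact// leqNgt np mul0r.
Qed.

Definition mertens n : R := \sum_(0 <= p < n.+1 | prime p) ln p%:R / p%:R.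

(** A prime [p <= n] occurs in [n!] at least [n %/ p > n / p - 1] times, so
    [n * mertens n - theta n <= ln n!]; the bounds on [theta n] and [ln n!] finish. *)
Lemma mertens_le n : (0 < n)%N -> mertens n <= ln n%:R + ln 4.
Proof.
move=> n0; have n0' : 0 < n%:R :> R by rewrite ltr0n.
rewrite -(ler_pM2l n0').
suff : n%:R * mertens n - theta n <= ln n`!%:R.
  by have := theta_le n; have := ln_fact_ub n; lra.
rewrite ln_fact_primes /mertens /theta mulr_sumr -sumrB big_nat_cond [leRHS]big_nat_cond.
apply: ler_sum => p /andP[/andP[_ pn] pp].
have p0 : 0 < p%:R :> R by rewrite ltr0n prime_gt0.
rewrite (_ : n%:R * _ - _ = (n%:R / p%:R - 1) * ln p%:R); last by field; rewrite gt_eqF.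
rewrite ler_wpM2r ?ln_nat_ge0// lerBlDr natr1 ler_pdivrMr// -natrM ler_nat.
apply: (@leq_trans ((n %/ p).+1 * p)%N); first by rewrite ltnW// ltn_ceil ?prime_gt0.
by rewrite leq_mul2r ltnS logn_fact// big_ltn// expn1 leq_addr orbT.
Qed.

(** Legendre's formula with the floors dropped is a geometric series of sum [n / (p - 1)]. *)
Lemma logn_fact_le n p : prime p -> (logn p n`!)%:R <= n%:R / (p%:R - 1) :> R.
Proof.
move=> pp; have p1 : 1 < p%:R :> R by rewrite ltr1n prime_gt1.
rewrite logn_fact//.
(* Keeping the exact geometric defect [1 - p ^ (- K)] makes the induction on [K] go through. *)
suff h K : (\sum_(1 <= k < K.+1) n %/ p ^ k)%N%:R <=
    n%:R / (p%:R - 1) * (1 - p%:R ^- K) :> R.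
  apply: (le_trans (h n)); apply: ler_piMr; first by rewrite divr_ge0// subr_ge0 ltW.
  by rewrite lerBlDr lerDl invr_ge0 exprn_ge0 ?ltW// (lt_trans _ p1).
elim: K => [|K IHK]; first by rewrite big_geq// expr0 invr1 subrr mulr0.
rewrite big_nat_recr//= natrD.
have : (n %/ p ^ K.+1)%N%:R <= n%:R * p%:R ^- K.+1 :> R.
  rewrite ler_pdivlMr ?exprn_gt0 ?(lt_trans _ p1)// -natrX -natrM ler_nat.
  exact: leq_trunc_div.
move/(lerD IHK)/le_trans; apply; rewrite exprS invfM.
have : p%:R ^- K != 0 :> R by rewrite invr_neq0// expf_neq0// gt_eqF// (lt_trans _ p1).
move: (p%:R ^- K) => y y0; rewrite le_eqVlt; apply/orP; left; apply/eqP.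
have pn0 : p%:R != 0 :> R by rewrite gt_eqF// (lt_trans _ p1).
have pn1 : p%:R - 1 != 0 :> R by rewrite subr_eq0 gt_eqF.
by field; rewrite ?pn0 ?pn1.
Qed.

(** The right side is built to telescope: its increment exceeds the new term by [(2 - (n + 1) * (ln
    (n + 1) - ln n)) / (n * (n + 1))], nonnegative because [(n + 1) / n <= 2]. *)
Lemma sum_ln_div_le n : (0 < n)%N ->
  \sum_(2 <= k < n.+1) ln k%:R / (k%:R * (k%:R - 1)) <= 2 - (ln n%:R + 2) / n%:R :> R.
Proof.
elim: n => // n IHn _; case: (posnP n) => [->|n0]; first by rewrite big_geq// ln1; lra.
rewrite big_nat_recr//=; apply: (le_trans (lerD (IHn n0) (lexx _))).
have n0' : 0 < n%:R :> R by rewrite ltr0n.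
have n1 : 1 <= n%:R :> R by rewrite ler1n.
have := lnS_le n0.
rewrite -(ler_pM2l n0') divff ?gt_eqF// -[n.+1%:R]natr1 addrK.
move: (ln n%:R) => x; move: (ln (n%:R + 1)) => y.
move: n%:R n0' n1 => z z0 z1 h.
rewrite -subr_ge0.
rewrite (_ : _ - _ = (2 - (z + 1) * (y - x)) / (z * (z + 1))); last first.
  by field; rewrite !gt_eqF//; lra.
by apply: divr_ge0; nra.
Qed.

(** Since [1 / (p - 1) = 1 / p + 1 / (p * (p - 1))], the multiplicities in [n!] cost at most [2 * n]
    beyond [n * mertens n]; the last unit of the [3] comes from [ln n! >= n ln n - n]. *)
Lemma mertens_ge n : (0 < n)%N -> ln n%:R - 3 <= mertens n.
Proof.
move=> n0; have n0' : 0 < n%:R :> R by rewrite ltr0n.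
suff : ln n`!%:R <= n%:R * (mertens n + 2).
  have h1 := ln_fact_lb n => h2; have h := le_trans h1 h2.
  by move: h; rewrite -[X in _ - X]mulr1 -mulrBr ler_pM2l//; lra.
apply: (@le_trans _ _ (n%:R * (mertens n + \sum_(2 <= k < n.+1) ln k%:R / (k%:R * (k%:R - 1))))); last first.
  rewrite ler_pM2l// lerD2l (le_trans (sum_ln_div_le n0))//.
  have : 0 <= (ln n%:R + 2) / n%:R :> R by rewrite divr_ge0// addr_ge0// ln_nat_ge0.
  lra.
have -> : mertens n = \sum_(2 <= p < n.+1 | prime p) ln p%:R / p%:R.
  rewrite /mertens (big_cat_nat (n := 2))//=.
  by rewrite big_mkcond 2?big_ltn//= big_geq// !add0r.
rewrite ln_fact_primes (big_cat_nat (n := 2))//=.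
rewrite [X in X + _]big_mkcond 2?big_ltn//= big_geq// !add0r.
rewrite [X in X + _]big_mkcond [leLHS]big_mkcond -big_split mulr_sumr /=.
rewrite big_nat_cond [leRHS]big_nat_cond; apply: ler_sum => p /andP[/andP[p2 _] _].
have p1 : 1 < p%:R :> R by rewrite ltr1n.
case: ifPn => [pp|_].
  rewrite (_ : n%:R * _ = n%:R / (p%:R - 1) * ln p%:R).
    by rewrite ler_wpM2r ?ln_nat_ge0// logn_fact_le.
  by field; rewrite subr_eq0 !gt_eqF// (lt_trans _ p1).
rewrite add0r !mulr_ge0 ?invr_ge0 ?mulr_ge0 ?subr_ge0 ?ln_nat_ge0//; exact: ltW.
Qed.

End PrimeSums.

(** * Gaussian moments *)

Section GaussMoments.
Variable R : realType.
Implicit Types (V W v B : R) (m n k : nat).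

Lemma expr_taylor2 k B : 0 <= B -> exists2 C : R, 0 <= C &
  forall V v, 0 <= V <= B -> 0 <= v <= 1 ->
  `|(V + v) ^+ k - V ^+ k - k%:R * v * V ^+ k.-1| <= C * v ^+ 2.
Proof.
move=> B0; elim: k => [|k [C C0 IHk]].
  by exists 0 => // V v _ _; rewrite !expr0 subrr !mul0r subrr normr0.
exists ((B + 1) * C + k%:R * B ^+ k.-1).
  by rewrite addr_ge0// !mulr_ge0 ?exprn_ge0// addr_ge0.
move=> V v /andP[V0 VB] /andP[v0 v1].
have := IHk V v; rewrite V0 VB v0 v1 => /(_ isT isT) {}IHk.
have -> : (V + v) ^+ k.+1 - V ^+ k.+1 - k.+1%:R * v * V ^+ k.+1.-1 =
  (V + v) * ((V + v) ^+ k - V ^+ k - k%:R * v * V ^+ k.-1)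
  + k%:R * v ^+ 2 * V ^+ k.-1.
  by case: k {IHk} => [|k]; rewrite -?natr1 /= ?exprS ?expr0; ring.
apply: (le_trans (ler_normD _ _)); rewrite [leRHS]mulrDl; apply: lerD.
  rewrite normrM -[leRHS]mulrA ler_pM//.
  by rewrite ger0_norm ?addr_ge0// lerD.
rewrite ger0_norm ?mulr_ge0 ?exprn_ge0// mulrAC ler_wpM2r ?exprn_ge0//.
by rewrite ler_wpM2l// lerXn2r.
Qed.

Lemma gauss_moment_even k V :
  gauss_moment k.*2 V = (k.*2`!)%:R / (k`!%:R * 2 ^+ k) * V ^+ k.
Proof. by rewrite /gauss_moment odd_double doubleK. Qed.

Lemma gauss_moment_odd m V : odd m -> gauss_moment m V = 0.
Proof. by rewrite /gauss_moment => ->. Qed.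

Lemma gauss_moment0 m : gauss_moment m (0 : R) = (m == 0%N)%:R.
Proof.
case: (boolP (odd m)) => [om|em]; first by rewrite gauss_moment_odd//; case: m om.
have := odd_double_half m; rewrite (negbTE em) add0n => <-.
rewrite gauss_moment_even; case: (m./2) => [|k]; last by rewrite expr0n mulr0.
by rewrite !expr0 !mulr1 divff.
Qed.

Lemma gauss_moment_ge0 m V : 0 <= V -> 0 <= gauss_moment m V.
Proof.
by move=> V0; rewrite /gauss_moment; case: ifP => // _; rewrite mulr_ge0 ?exprn_ge0.
Qed.

Lemma gauss_moment_le m V W : 0 <= V <= W -> gauss_moment m V <= gauss_moment m W.
Proof.
move=> /andP[V0 VW]; rewrite /gauss_moment; case: ifP => // _.
by rewrite ler_wpM2l// lerXn2r// nnegrE (le_trans V0).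
Qed.

(** Coefficient form of [d/dV gauss_moment (m + 2) V = 'C(m + 2, 2) * gauss_moment m V], the
    identity that matches the moment recursion of independent sums. *)
Lemma gauss_momentS k : ((k.+1.*2`!)%:R / (k.+1`!%:R * 2 ^+ k.+1) * k.+1%:R : R) =
  'C(k.+1.*2, 2)%:R * ((k.*2`!)%:R / (k`!%:R * 2 ^+ k)).
Proof.
have -> : 'C(k.+1.*2, 2) = (k.+1 * k.*2.+1)%N.
  by rewrite bin2 doubleS /= -!muln2; lia.
rewrite doubleS !factS exprS !natrM.
have -> : k.*2.+2%:R = 2 * k.+1%:R :> R by rewrite -natrM; congr _%:R; rewrite -muln2; lia.
have : k.+1%:R != 0 :> R by rewrite pnatr_eq0.
have : (k`!)%:R != 0 :> R by rewrite pnatr_eq0 -lt0n fact_gt0.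
have : 2 ^+ k != 0 :> R by rewrite expf_neq0// pnatr_eq0.
move: (k`!)%:R (2 ^+ k) (k.+1%:R) => x y z y0 x0 z0.
by field; rewrite x0 y0 z0.
Qed.

Lemma gauss_moment_taylor2 m B : 0 <= B -> exists2 C : R, 0 <= C &
  forall V v, 0 <= V <= B -> 0 <= v <= 1 ->
  `|gauss_moment m.+2 (V + v) - gauss_moment m.+2 V
     - 'C(m.+2, 2)%:R * v * gauss_moment m V| <= C * v ^+ 2.
Proof.
move=> B0; case: (boolP (odd m)) => [om|em].
  by exists 0 => // V v _ _; rewrite !gauss_moment_odd /= ?negbK// mulr0 !subr0 normr0 mul0r.
have := odd_double_half m; rewrite (negbTE em) add0n => <-.
set k := m./2; have [C C0 hC] := expr_taylor2 k.+1 B0.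
set c : R := k.+1.*2`!%:R / (k.+1`!%:R * 2 ^+ k.+1).
have c0 : 0 <= c by rewrite divr_ge0// mulr_ge0// exprn_ge0.
exists (c * C); first exact: mulr_ge0.
move=> V v hV hv; rewrite -doubleS !gauss_moment_even -/c.
rewrite [_ * v]mulrC -[_ * _ * (_ * V ^+ k)]mulrA [_%:R * (_ * _)]mulrA -gauss_momentS -/c.
rewrite (_ : _ - _ = c * ((V + v) ^+ k.+1 - V ^+ k.+1 - k.+1%:R * v * V ^+ k)); last by ring.
by rewrite normrM (ger0_norm c0) -[leRHS]mulrA ler_wpM2l// hC.
Qed.

(** Serves to replace the variance of the finite sum by [sigma2 f] inside the Gaussian moment. *)
Lemma gauss_moment_lipschitz m B : 0 <= B -> exists2 C : R, 0 <= C &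
  forall V W, `|V| <= B -> `|W| <= B ->
  `|gauss_moment m V - gauss_moment m W| <= C * `|V - W|.
Proof.
move=> B0; rewrite /gauss_moment; case: (odd m).
  by exists 0 => // V W _ _; rewrite subrr normr0 mul0r.
set c : R := _ / _; move: (m./2) => k.
have [C C0 hC] : exists2 C : R, 0 <= C & forall V W, `|V| <= B -> `|W| <= B ->
    `|V ^+ k - W ^+ k| <= C * `|V - W|.
  elim: k => [|k [C C0 hC]].
    by exists 0 => // V W _ _; rewrite !expr0 subrr normr0 mul0r.
  exists (B * C + B ^+ k); first by rewrite addr_ge0 ?mulr_ge0 ?exprn_ge0.
  move=> V W hV hW; rewrite (_ : _ - _ = V * (V ^+ k - W ^+ k) + W ^+ k * (V - W)); last first.
    by rewrite !exprS; ring.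
  apply: (le_trans (ler_normD _ _)); rewrite mulrDl !normrM lerD//.
    by rewrite -mulrA ler_pM// hC.
  by rewrite normrX ler_wpM2r// lerXn2r// nnegrE.
exists (`|c| * C); first exact: mulr_ge0.
by move=> V W hV hW; rewrite -mulrBr normrM -mulrA ler_wpM2l// hC.
Qed.

(* [M j k] and [y j k] stand for the [k]-th moments of the sum of the first [j] of [N]
   independent centered variables and of the [j]-th variable, which is bounded by [b j]. *)
Definition moment_rec (N n : nat) (M y : nat -> nat -> R) (b : nat -> R) :=
  [/\ forall m, M 0%N m = (m == 0%N)%:R,
      forall j m, (j < N)%N -> (m <= n)%N ->
        M j.+1 m = \sum_(i < m.+1) 'C(m, i)%:R * (M j (m - i)%N * y j i),
      forall j, (j < N)%N -> [/\ y j 0%N = 1, y j 1%N = 0 & 0 <= y j 2%N],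
      forall j i, (j < N)%N -> `|y j i| <= b j ^+ i &
      forall j, (j < N)%N -> 0 <= b j <= 1].

Lemma moment_recW N n n' M y b : (n <= n')%N -> moment_rec N n' M y b -> moment_rec N n M y b.
Proof.
move=> nn' [M0 Mrec y012 yb b01]; split => // j m jN mn.
by rewrite Mrec// (leq_trans mn).
Qed.

(** A Lindeberg-style comparison. Since the means vanish, adding variable [J] changes the [n]-th
    moment by ['C(n, 2) * y J 2 * M J (n - 2)] plus terms of order [b J ^ 3], and the Gaussian
    moment obeys the same law by Taylor expansion in the variance. The outer induction on [m]
    supplies the lower moments; [C] depends only on [m] and [B]. *)
Lemma moment_rec_gauss (B : R) m : 0 <= B -> exists2 C : R, 0 <= C &
  forall N M y b, moment_rec N m M y b -> \sum_(j < N) b j ^+ 2 <= B ->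
  forall k J, (k <= m)%N -> (J <= N)%N ->
  `|M J k - gauss_moment k (\sum_(j < J) y j 2%N)| <= C * \sum_(j < J) b j ^+ 3.
Proof.
move=> B0; elim: m => [|m [C C0 IHm]].
  exists 0 => // N M y b [M0 Mrec y012 _ _] _ [|//] J _ JN.
  rewrite mul0r normr_le0 subr_eq0; apply/eqP.
  rewrite /gauss_moment /= !expr0 !mulr1 divff//.
  elim: J JN => [|J IHJ] JN; first by rewrite M0.
  rewrite Mrec// big_ord_recl big_ord0 subn0 bin0 mul1r addr0 IHJ 1?ltnW//.
  by have [-> _ _] := y012 _ JN; rewrite mulr1.
(* First moments vanish exactly, every [y j 1] being [0], so the constant is kept. *)
case: m IHm => [|m] IHm.
  exists C => // N M y b Mr bB [|[|//]] J kJ JN.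
    by apply: (IHm N) => //; exact: moment_recW Mr.
  have [M0 Mrec y012 _ b01] := Mr.
  rewrite gauss_moment_odd// subr0; suff -> : M J 1%N = 0.
    rewrite normr0 mulr_ge0// sumr_ge0// => j _; rewrite exprn_ge0//.
    by have /andP[] := b01 _ (leq_trans (ltn_ord j) JN).
  elim: J JN {kJ} => [|J IHJ] JN; first by rewrite M0.
  rewrite Mrec// !big_ord_recl big_ord0 /= /bump /= IHJ 1?ltnW//.
  by have [_ -> _] := y012 _ JN; rewrite mul0r !mulr0 !addr0.
set n := m.+2.
have [Cg Cg0 hCg] := gauss_moment_taylor2 m B0.
pose Gb : R := \sum_(k < n) gauss_moment k B.
have Gb0 : 0 <= Gb by apply: sumr_ge0 => k _; exact: gauss_moment_ge0.
have hGb k V : (k < n)%N -> 0 <= V <= B -> `|gauss_moment k V| <= Gb.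
  move=> kn VB; have /andP[V0 _] := VB.
  rewrite ger0_norm ?gauss_moment_ge0// (le_trans (gauss_moment_le k VB))//.
  rewrite /Gb (bigD1 (Ordinal kn))//= lerDl sumr_ge0// => i _.
  exact: gauss_moment_ge0.
(* [K1] collects the binomial terms of index at least 3, with [C * B + Gb] bounding the lower
   moments; [K0] carries the error inherited from the moment of order [n - 2]. *)
pose K1 : R := \sum_(i < m) 'C(n, i.+3)%:R * (C * B + Gb).
have K10 : 0 <= K1 by apply: sumr_ge0 => i _; rewrite mulr_ge0// addr_ge0// mulr_ge0.
pose K0 : R := 'C(n, 2)%:R * C.
have K00 : 0 <= K0 by rewrite mulr_ge0.
exists (C + (K0 * B + (K1 + Cg))).
  by rewrite !addr_ge0// mulr_ge0.
move=> N M y b Mr bB k J kn JN.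
have [M0 Mrec y012 yb b01] := Mr.
have Mr' : moment_rec N m.+1 M y b by exact: moment_recW Mr.
have b0 j : (j < N)%N -> 0 <= b j by move/b01/andP => [].
have b1 j : (j < N)%N -> b j <= 1 by move/b01/andP => [].
pose S2 J : R := \sum_(j < J) b j ^+ 2.
pose S3 J : R := \sum_(j < J) b j ^+ 3.
pose V J : R := \sum_(j < J) y j 2%N.
have S20 i : (i <= N)%N -> 0 <= S2 i.
  by move=> iN; apply: sumr_ge0 => j _; rewrite exprn_ge0// b0// (leq_trans _ iN).
have S30 i : (i <= N)%N -> 0 <= S3 i.
  by move=> iN; apply: sumr_ge0 => j _; rewrite exprn_ge0// b0// (leq_trans _ iN).
have V0 i : (i <= N)%N -> 0 <= V i.
  by move=> iN; apply: sumr_ge0 => j _; have [] := y012 _ (leq_trans (ltn_ord j) iN).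
have S32 i : (i <= N)%N -> S3 i <= S2 i.
  move=> iN; apply: ler_sum => j _; have jN := leq_trans (ltn_ord j) iN.
  by rewrite exprSr ler_piMr ?exprn_ge0 ?b0 ?b1.
have y2b j : (j < N)%N -> y j 2%N <= b j ^+ 2.
  by move=> jN; rewrite (le_trans (ler_norm _)) ?yb.
have VS i : (i <= N)%N -> V i <= S2 i.
  by move=> iN; apply: ler_sum => j _; rewrite y2b// (leq_trans _ iN).
have S2B i : (i <= N)%N -> S2 i <= B.
  move=> iN; apply: le_trans bB; rewrite /S2 -!(big_mkord predT (fun j => b j ^+ 2)).
  rewrite (big_cat_nat (leq0n i) iN)/= lerDl big_nat_cond sumr_ge0// => j.
  by rewrite andbT => /andP[_ jN]; rewrite exprn_ge0 ?b0.
case: (leqP k m.+1) => [km|km].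
  apply: (le_trans (IHm _ _ _ _ Mr' bB _ _ km JN)).
  rewrite mulrDl lerDl mulr_ge0//; last exact: S30.
  by rewrite !addr_ge0// mulr_ge0.
have {kn km}-> : k = n by apply/eqP; rewrite eqn_leq kn.
(* The coefficient [K0 * S2 J] grows with [J], which lets the inner induction absorb the inherited
   errors [K0 * b J ^ 2 * S3 J]; at the end [S2 J <= B]. *)
suff h : `|M J n - gauss_moment n (V J)| <= (K0 * S2 J + (K1 + Cg)) * S3 J.
  apply: (le_trans h); rewrite ler_wpM2r ?S30// -[leLHS]add0r lerD// lerD2r.
  by rewrite ler_wpM2l// S2B.
elim: J JN => [|J IHJ] JN.
  by rewrite M0 /V big_ord0 gauss_moment0 subrr normr0 /S2 /S3 !big_ord0 mulr0.
have JN' := ltnW JN.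
have Mk j : (j <= m.+1)%N -> `|M J j| <= C * B + Gb.
  move=> jm; rewrite -(subrK (gauss_moment j (V J)) (M J j)).
  apply: (le_trans (ler_normD _ _)); apply: lerD.
    apply: (le_trans (IHm _ _ _ _ Mr' bB _ _ jm JN')).
    by rewrite ler_wpM2l// (le_trans (S32 _ JN'))// S2B.
  by apply: hGb => //; rewrite V0//= (le_trans (VS _ JN'))// S2B.
have [y0 y1 y2] := y012 _ JN.
set tail : R := \sum_(i < m) 'C(n, i.+3)%:R * (M J (n - i.+3)%N * y J i.+3).
have tail_le : `|tail| <= K1 * b J ^+ 3.
  apply: (le_trans (ler_norm_sum _ _ _)); rewrite /K1 mulr_suml; apply: ler_sum => i _.
  rewrite !normrM normr_nat -!mulrA ler_wpM2l// ler_pM// ?Mk//; first by lia.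
  apply: (le_trans (yb _ _ JN)).
  by rewrite -addn3 addnC exprD ler_piMr ?exprn_ge0 ?b0// exprn_ile1 ?b0 ?b1.
have Mn : M J.+1 n = M J n + 'C(n, 2)%:R * y J 2%N * M J m + tail.
  rewrite Mrec// -(big_mkord xpredT (fun i => 'C(n, i)%:R * (M J (n - i)%N * y J i))).
  rewrite /n 3?big_nat_recl// big_mkord -/n -/tail subn0 bin0 y0 y1.
  rewrite (_ : (n - 2)%N = m); first by ring.
  by rewrite /n subSS subSS subn0.
set grem := gauss_moment n (V J + y J 2%N) - gauss_moment n (V J)
     - 'C(n, 2)%:R * y J 2%N * gauss_moment m (V J).
have b3 : b J ^+ 4 <= b J ^+ 3 by rewrite exprSr ler_piMr ?exprn_ge0 ?b0 ?b1.
have grem_le : `|grem| <= Cg * b J ^+ 3.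
  apply: (@le_trans _ _ (Cg * y J 2%N ^+ 2)).
    apply: hCg; first by rewrite V0//= (le_trans (VS _ JN'))// S2B.
    by rewrite y2/= (le_trans (y2b _ JN))// exprn_ile1 ?b0 ?b1.
  rewrite ler_wpM2l// (le_trans _ b3)// (_ : 4 = 2 * 2)%N// exprM.
  by rewrite lerXn2r ?nnegrE ?exprn_ge0 ?b0 ?y2b.
have -> : V J.+1 = V J + y J 2%N by rewrite /V big_ord_recr.
have S2S : S2 J.+1 = S2 J + b J ^+ 2 by rewrite /S2 big_ord_recr.
have S3S : S3 J.+1 = S3 J + b J ^+ 3 by rewrite /S3 big_ord_recr.
have -> : M J.+1 n - gauss_moment n (V J + y J 2%N) =
  (M J n - gauss_moment n (V J)) + 'C(n, 2)%:R * (y J 2%N * (M J m - gauss_moment m (V J)))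
  + tail - grem by rewrite Mn /grem; ring.
have := IHm _ _ _ _ Mr' bB m J (leqnSn m) JN'; rewrite -/(V J) -/(S3 J) => hm.
have h2 : `|'C(n, 2)%:R * (y J 2%N * (M J m - gauss_moment m (V J)))| <= K0 * (b J ^+ 2 * S3 J).
  rewrite normrM normr_nat /K0 -mulrA ler_wpM2l// mulrCA normrM ler_pM//.
  by rewrite ger0_norm// y2b.
apply: (le_trans (ler_normB _ _)); apply: (le_trans (lerD (ler_normD _ _) (lexx _))).
apply: (le_trans (lerD (lerD (ler_normD _ _) (lexx _)) (lexx _))).
apply: (le_trans (lerD (lerD (lerD (IHJ JN') h2) tail_le) grem_le)).
rewrite S2S S3S.
have p2 : 0 <= K0 * (b J ^+ 2 * b J ^+ 3) by rewrite !mulr_ge0 ?exprn_ge0 ?b0.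
have p3 : 0 <= K0 * (S2 J * b J ^+ 3) by rewrite !mulr_ge0 ?exprn_ge0 ?b0 ?S20.
(* Expanding the claimed bound at [J + 1] leaves exactly these two nonnegative surplus terms. *)
rewrite -subr_ge0 (_ : _ - _ = K0 * (b J ^+ 2 * b J ^+ 3) + K0 * (S2 J * b J ^+ 3)); last by ring.
exact: addr_ge0.
Qed.

End GaussMoments.

(** * Averages against [w] *)

Section AffineChange.
Variable R : realType.
Let mu := @lebesgue_measure R.
Local Open Scope ereal_scope.

Lemma integral_mscale_integrable d (T : measurableType d)
    (m : {measure set T -> \bar R}) (k : {nonneg R}) (g : T -> \bar R) :
  m.-integrable setT g ->
  \int[mscale k m]_x g x = k%:num%:E * \int[m]_x g x.
Proof.
move=> ig; have mg := measurable_int m ig.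
rewrite [LHS]integralE [in RHS]integralE !ge0_integral_mscale//;
  [|exact: measurable_funeneg|exact: measurable_funepos].
rewrite [RHS]muleBr//; apply: fin_num_adde_defr.
exact: integrable_pos_fin_num.
Qed.

(** Both sides are measures with the same values on half-open intervals, and these values determine
    Lebesgue measure. *)
Lemma lebesgue_measure_affine (T H : R) (A : set R) : (0 < H)%R -> measurable A ->
  mu A = H%:E * pushforward mu (fun x : measurableTypeR R => (T + H * x)%R : measurableTypeR R) A.
Proof.
move=> H0 mA.
pose phi (x : measurableTypeR R) : measurableTypeR R := (T + H * x)%R.
have mphi : measurable_fun [set: measurableTypeR R] phi.
  by apply: measurable_funD => //; exact: measurable_funM.
pose nu := mscale (NngNum (ltW H0)) (pushforward mu phi).
suff -> : mu A = nu mphi A by [].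
apply: lebesgue_measure_unique => //= _ [[a b]] _ <-.
rewrite /mscale /= (_ : pushforward _ _ _ = mu `](a - T) / H, (b - T) / H]%classic)%R; last first.
  congr lebesgue_measure; apply/seteqP; split => x; rewrite /phi/= !in_itv/=;
    by rewrite ltr_pdivrMr// ler_pdivlMr// ltrBlDl lerBrDl [(x * H)%R]mulrC.
rewrite /mu !lebesgue_measure_itv/= !lte_fin ltr_pM2r ?invr_gt0// ltrD2r.
case: ifPn => ab; last by rewrite mule0.
by rewrite -!EFinB -EFinM; congr EFin; field; rewrite gt_eqF.
Qed.

End AffineChange.

Section Averages.
Variable R : realType.
Variable w : R -> R.
Hypotheses (w0 : forall x, 0 <= w x) (iw : Lint w) (w1 : intR w = 1).
Let mu := @lebesgue_measure R.
Implicit Types (F G : R -> R) (T H : R).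

Definition bcont F := continuous F /\ exists M, forall x, `|F x| <= M.

(** The window average after the substitution [tau = T + H * x]: the expectation of [F (T + H * X)]
    when [X] has density [w]. *)
Definition tavg T H F : R := intR (fun x => F (T + H * x) * w x).

Lemma bcont_affine T H F : bcont F -> bcont (fun x => F (T + H * x)).
Proof.
move=> [cF [M hM]]; split; last by exists M.
move=> x; apply: (@continuous_comp _ _ _ (fun x : R => T + H * x) F); last exact: cF.
by apply: cvgD; [exact: cvg_cst|apply: cvgM; [exact: cvg_cst|exact: cvg_id]].
Qed.

Lemma integrable_bcontM F : bcont F -> mu.-integrable setT (EFin \o (fun x => F x * w x)).
Proof.
move=> [cF [M hM]].
have -> : EFin \o (fun x => F x * w x) = ((EFin \o F) \* (EFin \o w))%E by [].
apply: integrableMr => //; first exact: continuous_measurable_fun.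
by exists M; split; [exact: num_real|move=> y My x _; apply: le_trans (hM x) (ltW My)].
Qed.

Lemma tavg_sum T H (I : Type) (s : seq I) (P : pred I) (c : I -> R) (F : I -> R -> R) :
  (forall i, bcont (F i)) ->
  tavg T H (fun t => \sum_(i <- s | P i) c i * F i t) = \sum_(i <- s | P i) c i * tavg T H (F i).
Proof.
move=> bF; rewrite /tavg /intR.
have iF i : mu.-integrable setT (EFin \o (fun x => F i (T + H * x) * w x)).
  by apply: integrable_bcontM; apply: bcont_affine; exact: bF.
rewrite /Rintegral.
under eq_integral do rewrite mulr_suml -sumEFin.
rewrite integral_sum//; last first.
  move=> i; rewrite /=.
  rewrite (_ : (fun _ => _) = (fun x => (c i)%:E * (F i (T + H * x) * w x)%:E)%E).
    by apply: integrableZl => //; exact: iF.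
  by apply/funext => x; rewrite -EFinM mulrA.
rewrite (eq_bigr (fun i => (c i * tavg T H (F i))%:E)); first by rewrite sumEFin.
move=> i _; under eq_integral do rewrite -mulrA EFinM.
rewrite integralZl//; last exact: iF.
by rewrite EFinM fineK//; apply: integrable_fin_num => //; exact: iF.
Qed.

Lemma tavg_le T H F M : bcont F -> (forall x, `|F x| <= M) -> `|tavg T H F| <= M.
Proof.
move=> bF hM; have ib := integrable_bcontM (bcont_affine T H bF).
apply: (le_trans (le_normr_Rintegral _ _)) => //.
have M0 : 0 <= M by apply: le_trans (hM 0).
have -> : M = M * intR w by rewrite w1 mulr1.
rewrite /intR -RintegralZl//.
apply: le_Rintegral => //.
- exact: (@integrable_norm _ _ _ _ _ _ ib).
- rewrite (_ : _ \o _ = (fun x => M%:E * (EFin \o w) x)%E)//.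
  exact: integrableZl.
- by move=> x _; rewrite normrM (ger0_norm (w0 x)) ler_wpM2r.
Qed.

Lemma tavg_ge0 T H F : (forall x, 0 <= F x) -> 0 <= tavg T H F.
Proof. by move=> F0; apply: Rintegral_ge0 => x _; rewrite mulr_ge0. Qed.

(** Lebesgue measure is [H] times its image under [x |-> T + H * x]; pulling the integral back along
    this map, the factor [H] cancels the division by [H]. *)
Lemma avg_tavg T H F : 0 < H -> bcont F -> avg w F T H = tavg T H F.
Proof.
move=> H0 bF; rewrite /avg /tavg /intR.
have H0' : H != 0 by rewrite gt_eqF.
pose phi (x : measurableTypeR R) : measurableTypeR R := T + H * x.
have mphi : measurable_fun [set: measurableTypeR R] phi.
  by apply: measurable_funD => //; exact: measurable_funM.
have mw : measurable_fun [set: R] w by have := measurable_int _ iw => /measurable_EFinP.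
pose g x : R := F x * w ((x - T) / H) / H.
have gphi x : g (phi x) = H^-1 * (F (T + H * x) * w x).
  by rewrite /g /phi (_ : (T + H * x - T) / H = x); [rewrite mulrC|field].
have mg : measurable_fun [set: measurableTypeR R] g.
  apply: measurable_funM => //; apply: measurable_funM.
    by case: bF => cF _; exact: continuous_measurable_fun.
  apply: (measurableT_comp mw); apply: measurable_funM => //.
  by apply: measurable_funB.
pose nu := mscale (NngNum (ltW H0)) (pushforward mu phi).
have igphi : mu.-integrable setT ((EFin \o g) \o phi).
  rewrite (_ : _ \o _ = (fun x => (H^-1)%:E * (F (T + H * x) * w x)%:E)%E).
    apply: integrableZl => //; apply: integrable_bcontM; exact: bcont_affine.
  by apply/funext => x /=; rewrite gphi EFinM.
congr fine.
rewrite (@eq_measure_integral _ _ _ _ (nu mphi)); last first.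
  by move=> A mA _; exact: lebesgue_measure_affine.
rewrite /nu integral_mscale_integrable; last first.
  have mg' : measurable_fun [set: measurableTypeR R] (EFin \o g) by exact/measurable_EFinP.
  exact: (integrable_pushforward (D := setT) mphi mg' igphi measurableT).
rewrite (integral_pushforward mphi)//; last exact/measurable_EFinP.
rewrite preimage_setT.
under eq_integral do rewrite /= -/(g (phi _)) gphi EFinM.
rewrite integralZl//; last by apply: integrable_bcontM; exact: bcont_affine.
by rewrite muleA -EFinM divff// mul1e.
Qed.

End Averages.

(** * Logarithmic frequencies and trigonometric polynomials *)

Section LogFrequencies.
Variable R : realType.
Implicit Types (nu : nat_pred) (K l : R).

(** The numbers [ln (P / Q)] with [P], [Q] composed of primes in [nu]. Bounding the product [P * Q]
    makes heights multiply when frequencies are added or subtracted, and still bounds the smaller of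
    [P] and [Q] by [sqrt K]. *)
Definition logfreq nu K : set R :=
  [set l | exists P Q : nat, [/\ nu.-nat P, nu.-nat Q, (P * Q)%:R <= K &
    l = ln P%:R - ln Q%:R]].

Lemma logfreqN nu K l : logfreq nu K l -> logfreq nu K (- l).
Proof.
by move=> [P [Q [piP piQ PQ ->]]]; exists Q, P; rewrite mulnC opprB.
Qed.

Lemma logfreqD nu K1 K2 l1 l2 : logfreq nu K1 l1 -> logfreq nu K2 l2 ->
  logfreq nu (K1 * K2) (l1 + l2).
Proof.
move=> [P [Q [piP piQ PQ ->]]] [P' [Q' [piP' piQ' PQ' ->]]].
have [/andP[P0 _] /andP[Q0 _]] := (piP, piQ).
have [/andP[P0' _] /andP[Q0' _]] := (piP', piQ').
exists (P * P')%N, (Q * Q')%N; split; rewrite ?pnatM ?piP ?piQ//.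
  by rewrite mulnACA natrM ler_pM.
by rewrite !natrM !lnM ?posrE ?ltr0n//; ring.
Qed.

Lemma logfreqW nu1 nu2 K1 K2 : {subset nu1 <= nu2} -> K1 <= K2 ->
  logfreq nu1 K1 `<=` logfreq nu2 K2.
Proof.
move=> nu12 K12 l [P [Q [piP piQ PQ ->]]]; exists P, Q; split => //.
- by apply: sub_in_pnat piP => p _; exact: nu12.
- by apply: sub_in_pnat piQ => p _; exact: nu12.
- exact: le_trans K12.
Qed.

Lemma logfreq0 nu K : 1 <= K -> logfreq nu K 0.
Proof. by move=> K1; exists 1%N, 1%N; rewrite subrr. Qed.

Lemma ln_nat_inj (m n : nat) : (0 < m)%N -> (0 < n)%N ->
  ln m%:R = ln n%:R :> R -> m = n.
Proof.
by move=> m0 n0 /ln_inj; rewrite !posrE !ltr0n => /(_ m0 n0)/eqP; rewrite eqr_nat => /eqP.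
Qed.

(* Unique factorization makes the logarithms of disjoint sets of primes linearly independent. *)
Lemma logfreq_indep nu K1 K2 l1 l2 : logfreq nu K1 l1 -> logfreq (negn nu) K2 l2 ->
  (l1 + l2 == 0) = (l1 == 0) && (l2 == 0).
Proof.
move=> [P [Q [piP piQ PQ ->]]] [P' [Q' [piP' piQ' PQ' ->]]].
have [/andP[P0 _] /andP[Q0 _]] := (piP, piQ).
have [/andP[P0' _] /andP[Q0' _]] := (piP', piQ').
apply/eqP/andP => [e|[/eqP -> /eqP ->]]; last by rewrite addr0.
have ePQ : (P * P' = Q * Q')%N.
  apply: ln_nat_inj; rewrite ?muln_gt0 ?P0 ?Q0//.
  by rewrite !natrM !lnM ?posrE ?ltr0n//; lra.
(* Taking [nu]-parts of [P * P' = Q * Q'] isolates [P] on one side and [Q] on the other. *)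
have eP : P = Q.
  have := congr1 (fun n => n`_nu)%N ePQ.
  by rewrite !partnM// !(part_pnat_id piP, part_pnat_id piQ) !part_p'nat// !muln1.
by move: e; rewrite eP subrr add0r => ->; rewrite eqxx.
Qed.

(* If [P > Q] then [ln (P / Q) >= 1 / (Q + 1)], and [Q ^ 2 <= P * Q <= K]. *)
Lemma logfreq_gap nu K l : logfreq nu K l -> l != 0 -> (2 * Num.sqrt K)^-1 <= `|l|.
Proof.
have key (P Q : nat) : (0 < Q)%N -> (Q < P)%N -> (P * Q)%:R <= K ->
    (2 * Num.sqrt K)^-1 <= ln P%:R - ln Q%:R.
  move=> Q0 QP PQ; have Q0' : 0 < Q%:R :> R by rewrite ltr0n.
  have QK : Q%:R <= Num.sqrt K.
    rewrite -(ger0_norm (ltW Q0')) -sqrtr_sqr ler_wsqrtr// (le_trans _ PQ)//.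
    by rewrite -natrX ler_nat expnS expn1 leq_mul2r ltnW// orbT.
  apply: (@le_trans _ _ Q.+1%:R^-1).
    rewrite lef_pV2 ?posrE ?ltr0n//; last by rewrite mulr_gt0// (lt_le_trans Q0').
    apply: (@le_trans _ _ (2 * Q%:R)); last by rewrite ler_pM2l.
    by rewrite -natrM ler_nat; lia.
  apply: (le_trans (lnS_ge R Q0)); rewrite lerD2r ler_ln ?posrE ?ltr0n ?ler_nat//.
  exact: leq_ltn_trans QP.
move=> [P [Q [piP piQ PQ ->]]] l0.
have [/andP[P0 _] /andP[Q0 _]] := (piP, piQ).
case: (ltngtP Q P) => QP.
- by apply: le_trans (ler_norm _); exact: key.
- by rewrite distrC; apply: le_trans (ler_norm _); apply: key => //; rewrite mulnC.
- by rewrite QP subrr eqxx in l0.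
Qed.

End LogFrequencies.

(** * Cosine polynomials with prescribed frequencies *)

Section TrigPolynomials.
Variable R : realType.
Implicit Types (A B : set R) (F G : R -> R) (K : R) (nu : nat_pred).

(** The list holds pairs of a coefficient and a frequency. Cosines alone are closed under products,
    by [2 cos x cos y = cos (x + y) + cos (x - y)]. *)
Definition tpoly A F := exists s : seq (R * R),
  (forall x, x \in s -> A x.2) /\ F = fun t => \sum_(x <- s) x.1 * cos (x.2 * t).

Lemma continuous_comp_scale (c : R) (g : R -> R) :
  continuous g -> continuous (fun t => g (c * t)).
Proof.
move=> cg x; apply: (@continuous_comp _ _ _ (fun t : R => c * t) g); last exact: cg.
by apply: cvgM; [exact: cvg_cst|exact: cvg_id].
Qed.

Lemma bcont_cos (c : R) : bcont (fun t => cos (c * t)).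
Proof.
split; first by apply: continuous_comp_scale; exact: continuous_cos.
by exists 1 => x; rewrite ler_norml cos_geN1 cos_le1.
Qed.

Lemma bcont_sin (c : R) : bcont (fun t => sin (c * t)).
Proof.
split; first by apply: continuous_comp_scale; exact: continuous_sin.
by exists 1 => x; rewrite ler_norml sin_geN1 sin_le1.
Qed.

Lemma bcontD F G : bcont F -> bcont G -> bcont (fun t => F t + G t).
Proof.
move=> [cF [M hM]] [cG [N hN]]; split.
  by move=> x; apply: cvgD; [exact: cF|exact: cG].
by exists (M + N) => x; rewrite (le_trans (ler_normD _ _))// lerD.
Qed.

Lemma bcontZ (c : R) F : bcont F -> bcont (fun t => c * F t).
Proof.
move=> [cF [M hM]]; split.
  by move=> x; apply: cvgM; [exact: cvg_cst|exact: cF].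
by exists (`|c| * M) => x; rewrite normrM ler_wpM2l.
Qed.

Lemma tpoly_bcont A F : tpoly A F -> bcont F.
Proof.
move=> [s [_ ->]]; elim: s => [|x s IHs].
  under eq_fun do rewrite big_nil.
  by split; [exact: cst_continuous|exists 0 => x; rewrite normr0].
under eq_fun do rewrite big_cons.
by apply: bcontD => //; apply: bcontZ; exact: bcont_cos.
Qed.

Lemma tpolyS A B F : A `<=` B -> tpoly A F -> tpoly B F.
Proof. by move=> AB [s [As ->]]; exists s; split => // x /As/AB. Qed.

Lemma tpoly0 A : tpoly A (fun=> 0).
Proof. by exists [::]; split => //; apply/funext => t; rewrite big_nil. Qed.

Lemma tpolyD A F G : tpoly A F -> tpoly A G -> tpoly A (fun t => F t + G t).
Proof.
move=> [s [As ->]] [s' [As' ->]]; exists (s ++ s'); split.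
  by move=> x; rewrite mem_cat => /orP[/As|/As'].
by apply/funext => t; rewrite big_cat.
Qed.

Lemma tpoly_sum A (I : Type) (s : seq I) (P : pred I) (F : I -> R -> R) :
  (forall i, P i -> tpoly A (F i)) -> tpoly A (fun t => \sum_(i <- s | P i) F i t).
Proof.
move=> AF; elim: s => [|i s IHs].
  by under eq_fun do rewrite big_nil; exact: tpoly0.
under eq_fun do rewrite big_cons.
case: (boolP (P i)) => // Pi; apply: tpolyD => //; exact: AF.
Qed.

Lemma tpoly_cos A (c l : R) : A l -> tpoly A (fun t => c * cos (l * t)).
Proof.
move=> Al; exists [:: (c, l)]; split; first by move=> x; rewrite inE => /eqP ->.
by apply/funext => t; rewrite big_seq1.
Qed.

Definition tmul (s s' : seq (R * R)) : seq (R * R) :=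
  [seq (x.1 * y.1 / 2, x.2 + y.2) | x <- s, y <- s'] ++
  [seq (x.1 * y.1 / 2, x.2 - y.2) | x <- s, y <- s'].

Lemma tmulE s s' t :
  (\sum_(x <- s) x.1 * cos (x.2 * t)) * (\sum_(x <- s') x.1 * cos (x.2 * t)) =
  \sum_(x <- tmul s s') x.1 * cos (x.2 * t).
Proof.
rewrite /tmul big_cat !big_allpairs_dep /= -big_split big_distrl/=; apply: eq_bigr => x _.
rewrite big_distrr /= -big_split; apply: eq_bigr => y _ /=.
by rewrite !mulrDl mulNr cosD cosB; lra.
Qed.

Lemma tpolyM nu K1 K2 F G : tpoly (logfreq nu K1) F -> tpoly (logfreq nu K2) G ->
  tpoly (logfreq nu (K1 * K2)) (fun t => F t * G t).
Proof.
move=> [s [As ->]] [s' [As' ->]]; exists (tmul s s'); split; last first.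
  by apply/funext => t; rewrite tmulE.
move=> z; rewrite mem_cat => /orP[] /allpairsP[[x y] /= [xs ys ->]] /=.
  by apply: logfreqD; [exact: As|exact: As'].
by apply: logfreqD; [exact: As|apply: logfreqN; exact: As'].
Qed.

Lemma tpolyX nu K F n : tpoly (logfreq nu K) F ->
  tpoly (logfreq nu (K ^+ n)) (fun t => F t ^+ n).
Proof.
move=> tF; elim: n => [|n IHn].
  rewrite (_ : (fun _ => _) = fun t => 1 * cos (0 * t)).
    by apply: tpoly_cos; rewrite expr0; exact: logfreq0.
  by apply/funext => t; rewrite mul0r cos0 mulr1.
by under eq_fun do rewrite exprS; rewrite exprS; exact: tpolyM.
Qed.

End TrigPolynomials.

(** * Window averages of cosine polynomials *)

Section TrigAverages.
Variable R : realType.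
Variable w : R -> R.
Hypotheses (w0 : forall x, 0 <= w x) (iw : Lint w) (w1 : intR w = 1).
Implicit Types (T H : R) (K : R) (nu : nat_pred) (F G : R -> R).

Lemma tavg_cos0 T H : tavg w T H (fun t => cos (0 * t)) = 1.
Proof.
by rewrite /tavg -[RHS]w1; congr intR; apply/funext => x; rewrite mul0r cos0 mul1r.
Qed.

(** Expanding [cos (l * (T + H * x))] expresses the average through the cosine and sine integrals of
    [w] at [l * H], which up to sign are the two parts of its Fourier transform at [u]. *)
Lemma tavg_cos T H l (u := l * H / (2 * pi)) : ft_re w u = 0 -> ft_im w u = 0 ->
  tavg w T H (fun t => cos (l * t)) = 0.
Proof.
have hu x : 2 * pi * x * u = l * H * x.
  have p0 : pi != 0 :> R by rewrite gt_eqF ?pi_gt0.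
  by rewrite /u; move: p0; move: (@pi R) => c c0; field.
have -> : ft_re w u = intR (fun x => cos (l * H * x) * w x).
  by congr intR; apply/funext => x; rewrite hu mulrC.
have -> : ft_im w u = - intR (fun x => sin (l * H * x) * w x).
  by congr (- intR _); apply/funext => x; rewrite hu mulrC.
move=> re0 /eqP; rewrite oppr_eq0 => /eqP im0.
rewrite /tavg (_ : (fun x => _) = fun x => cos (l * T) * (cos (l * H * x) * w x)
    - sin (l * T) * (sin (l * H * x) * w x)); last first.
  by apply/funext => x; rewrite mulrDr mulrA cosD; ring.
have iC := integrable_bcontM iw (bcont_cos (l * H)).
have iS := integrable_bcontM iw (bcont_sin (l * H)).
rewrite /intR RintegralB//; last 2 first.
- exact: (@integrableZl _ _ _ _ _ _ (cos (l * T)) _ iC).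
- exact: (@integrableZl _ _ _ _ _ _ (sin (l * T)) _ iS).
by rewrite !RintegralZl// -/(intR _) re0 -/(intR _) im0 !mulr0 subr0.
Qed.

(* The window of length [H] separates all frequencies of height at most [K] from [0]. *)
Definition resolved T H K := forall l, logfreq predT K l -> l != 0 ->
  tavg w T H (fun t => cos (l * t)) = 0.

Lemma tavg_tpoly T H K (s : seq (R * R)) : resolved T H K ->
  (forall x, x \in s -> logfreq predT K x.2) ->
  tavg w T H (fun t => \sum_(x <- s) x.1 * cos (x.2 * t)) = \sum_(x <- s) x.1 * (x.2 == 0)%:R.
Proof.
move=> res sK; rewrite tavg_sum//; last by move=> i; exact: bcont_cos.
rewrite big_seq [RHS]big_seq; apply: eq_bigr => x xs; congr (_ * _).
case: eqVneq => [->|x0]; first exact: tavg_cos0.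
by apply: res => //; exact: sK.
Qed.

(** In the product, [l1 + l2] and [l1 - l2] vanish only when [l1 = l2 = 0], by unique factorization;
    the two halves then add up to the product of the constant terms. *)
Lemma tavg_indep T H nu K1 K2 F G : 1 <= K1 -> 1 <= K2 -> resolved T H (K1 * K2) ->
  tpoly (logfreq nu K1) F -> tpoly (logfreq (negn nu) K2) G ->
  tavg w T H (fun t => F t * G t) = tavg w T H F * tavg w T H G.
Proof.
move=> K1_ge1 K2_ge1 res [s [As ->]] [s' [As' ->]].
have subT (p : nat_pred) : {subset p <= predT} by [].
have K10 : 0 <= K1 by apply: le_trans K1_ge1.
have K20 : 0 <= K2 by apply: le_trans K2_ge1.
have sK x : x \in s -> logfreq predT (K1 * K2) x.2.
  by move/As; apply: logfreqW => //; rewrite ler_peMr.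
have sK' x : x \in s' -> logfreq predT (K1 * K2) x.2.
  by move/As'; apply: logfreqW => //; rewrite ler_peMl.
rewrite (tavg_tpoly res sK) (tavg_tpoly res sK').
under eq_fun do rewrite tmulE.
rewrite (tavg_tpoly res); last first.
  move=> z; rewrite mem_cat => /orP[] /allpairsP[[x y] /= [xs ys ->]] /=.
    by apply: logfreqD; [apply: logfreqW (As _ xs)|apply: logfreqW (As' _ ys)].
  by apply: logfreqD; [apply: logfreqW (As _ xs)|apply/logfreqN; apply: logfreqW (As' _ ys)].
rewrite /tmul big_cat !big_allpairs_dep /= -big_split big_distrl/= big_seq [RHS]big_seq.
apply: eq_bigr => x xs; rewrite big_distrr /= -big_split /= big_seq [RHS]big_seq.
apply: eq_bigr => y ys /=.
rewrite (logfreq_indep (As _ xs) (As' _ ys)) (logfreq_indep (As _ xs) (logfreqN (As' _ ys))).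
by rewrite oppr_eq0; case: (x.2 == 0); case: (y.2 == 0) => /=; field.
Qed.

(** The heights of the two factors in each binomial term multiply to exactly [K ^ n], the height
    assumed resolved. *)
Lemma tavg_binomial T H nu K F G n : 1 <= K -> resolved T H (K ^+ n) ->
  tpoly (logfreq nu K) F -> tpoly (logfreq (negn nu) K) G ->
  tavg w T H (fun t => (F t + G t) ^+ n) =
  \sum_(i < n.+1) 'C(n, i)%:R *
    (tavg w T H (fun t => F t ^+ (n - i)) * tavg w T H (fun t => G t ^+ i)).
Proof.
move=> K1 res tF tG.
rewrite (_ : (fun t => (F t + G t) ^+ n) =
  fun t => \sum_(i < n.+1) 'C(n, i)%:R * (F t ^+ (n - i) * G t ^+ i)); last first.
  by apply/funext => t; rewrite exprDn; apply: eq_bigr => i _; rewrite mulr_natl.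
have tFX i : tpoly (logfreq predT (K ^+ (n - i))) (fun t => F t ^+ (n - i)).
  by apply: tpolyS (tpolyX (n - i) tF); exact: logfreqW.
have tGX i : tpoly (logfreq predT (K ^+ i)) (fun t => G t ^+ i).
  by apply: tpolyS (tpolyX i tG); exact: logfreqW.
rewrite tavg_sum//; last first.
  by move=> i; apply: tpoly_bcont (tpolyM (tFX i) (tGX i)).
apply: eq_bigr => i _; congr (_ * _).
apply: (tavg_indep (nu := nu) (K1 := K ^+ (n - i)) (K2 := K ^+ i)).
- exact: exprn_ege1.
- exact: exprn_ege1.
- by rewrite -exprD subnK// -ltnS.
- exact: tpolyX.
- exact: tpolyX.
Qed.

End TrigAverages.

(** * Riemann sums over the primes *)

Section PrimeRiemannSums.
Variable R : realType.
Let mu := @lebesgue_measure R.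
Implicit Types (g phi : R -> R) (a b c x y u : R).

Lemma continuous_bounded_itv g a b : a <= b -> continuous g ->
  exists2 F : R, 0 <= F & forall x, a <= x <= b -> `|g x| <= F.
Proof.
move=> ab cg; have cn : {within `[a, b], continuous (fun x => `|g x|)}.
  by apply: continuous_subspaceT => x; apply: continuous_comp; [exact: cg|exact: norm_continuous].
have [c _ hc] := EVT_max ab cn.
by exists `|g c| => // x xab; apply: hc; rewrite in_itv.
Qed.

Lemma derivable_continuous g : (forall x, derivable g x 1) -> continuous g.
Proof. by move=> dg x; apply: differentiable_continuous; apply/derivable1_diffP. Qed.

Lemma lipschitz_itv g a b : a <= b -> (forall x, derivable g x 1) -> continuous (g^`())%classic ->
  exists2 K : R, 0 <= K & forall x y, a <= x <= b -> a <= y <= b -> `|g x - g y| <= K * `|x - y|.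
Proof.
move=> ab dg cdg; have [K K0 hK] := continuous_bounded_itv ab cdg.
exists K => //.
have key x y : a <= x -> x <= y -> y <= b -> `|g y - g x| <= K * `|y - x|.
  move=> ax xy yb; have [||z zxy ->] := @MVT_segment R g (g^`())%classic x y xy.
  - by move=> z _; split; [exact: dg|rewrite derive1E].
  - by apply: continuous_subspaceT; exact: derivable_continuous.
  rewrite normrM ler_wpM2r// hK//; move: zxy; rewrite in_itv/= => /andP[xz zy].
  by rewrite (le_trans ax)//= (le_trans zy).
move=> x y /andP[ax xb] /andP[ay yb]; case: (leP x y) => xy.
  by rewrite distrC [`|x - y|]distrC key.
by rewrite key// ltW.
Qed.

Lemma integrable_itv_continuous phi a b : continuous phi ->
  mu.-integrable `[a, b] (EFin \o phi).
Proof.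
move=> cphi; apply: continuous_compact_integrable; first exact: segment_compact.
exact: continuous_subspaceT.
Qed.

(** The mean value theorem turns the integral over [[x, y]] into [(y - x) * phi z]. The base point
    [a] lies strictly left of [x] so that the antiderivative is differentiable at [x] as well. *)
Lemma riemann_rect phi a x y (K : R) : continuous phi -> a < x -> x <= y ->
  (forall z, x <= z <= y -> `|phi z - phi y| <= K * `|z - y|) ->
  `|(\int[mu]_(t in `[a, y]) phi t)%R - (\int[mu]_(t in `[a, x]) phi t)%R - (y - x) * phi y|
    <= K * (y - x) ^+ 2.
Proof.
move=> cphi ax xy hK.
have FTC z : a < z -> is_derive z 1 (fun s => (\int[mu]_(t in `[a, s]) phi t)%R) (phi z).
  move=> az; have [] := @continuous_FTC1_closed R phi a z (z + 1) _ _ az (cphi z).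
  - by rewrite ltrDl.
  - exact: integrable_itv_continuous.
  move=> dF eF; apply: DeriveDef; [exact: dF|].
  by rewrite -derive1E; exact: eF.
have [||z zxy ->] := @MVT_segment R (fun s => (\int[mu]_(t in `[a, s]) phi t)%R) phi x y xy.
- by move=> z; rewrite in_itv/= => /andP[xz _]; apply: FTC; exact: lt_trans xz.
- apply: continuous_in_subspaceT => z; rewrite inE/= in_itv/= => /andP[xz _].
  apply: differentiable_continuous; apply/derivable1_diffP.
  by have [] := FTC z (lt_le_trans ax xz).
move: zxy; rewrite in_itv/= => zxy.
rewrite [_ * phi y]mulrC -mulrBl normrM (ger0_norm (x := y - x)) ?subr_ge0//.
rewrite expr2 mulrA ler_wpM2r ?subr_ge0// (le_trans (hK z zxy))//.
(* [K] carries no sign assumption; the Lipschitz bound at [z] forces [0 <= K] unless [z = y]. *)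
have [/andP[xz zy] K0] : x <= z <= y /\ (0 <= K \/ z = y).
  split => //; have := hK z zxy; case: (eqVneq z y) => [|zy h]; [by right|left].
  have : 0 <= K * `|z - y| by apply: le_trans h.
  by rewrite pmulr_lge0// normr_gt0 subr_eq0.
case: K0 => [K0|->]; last first.
  rewrite subrr normr0 mulr0; move: (hK x); rewrite lexx xy => /(_ isT) h.
  by rewrite -(ger0_norm (x := y - x)) ?subr_ge0// distrC (le_trans _ h).
by rewrite ler_wpM2l// distrC ger0_norm ?subr_ge0// lerD2l lerN2.
Qed.

Lemma mertensS n : mertens R n.+1 = mertens R n +
  (if prime n.+1 then ln n.+1%:R / n.+1%:R else 0).
Proof. by rewrite /mertens big_mkcond big_nat_recr//= -big_mkcond. Qed.

Lemma mertens_err n : (0 < n)%N -> `|mertens R n - ln n%:R| <= 4.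
Proof.
move=> n0; rewrite ler_norml; apply/andP; split.
  by have := mertens_ge R n0; lra.
have := mertens_le R n0; have : ln 4 < 4 :> R by apply: ln_sublinear.
lra.
Qed.

(* Abel summation against Mertens' theorem, combined with the comparison of each
   [(x_{n+1} - x_n) phi(x_{n+1})] to the integral of [phi], where [x_n = ln n / L]. *)
Lemma prime_riemann_sum phi (K L : R) N : continuous phi -> phi 0 = 0 -> 0 <= K -> 0 < L ->
  (forall x y, 0 <= x <= 2 -> 0 <= y <= 2 -> `|phi x - phi y| <= K * `|x - y|) ->
  (0 < N)%N -> ln N%:R <= 2 * L ->
  `| \sum_(2 <= n < N.+1 | prime n) ln n%:R / n%:R * phi (ln n%:R / L)
     - L * ((\int[mu]_(t in `[-1, ln N%:R / L]) phi t)%R - (\int[mu]_(t in `[-1, 0%R]) phi t)%R)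
     - (mertens R N - ln N%:R) * phi (ln N%:R / L)| <= 5 * K * (ln N%:R / L).
Proof.
move=> cphi phi0 K0 L0 lip; elim: N => // N IHN _ NL.
case: (posnP N) => [->|N0].
  by rewrite big_geq// ln1 mul0r phi0 !(subrr, mulr0, subr0) normr0.
have ln_le : ln N%:R <= ln N.+1%:R :> R by rewrite ler_ln ?posrE ?ltr0n ?ler_nat.
have {}IHN := IHN N0 (le_trans ln_le NL).
have L0' : L != 0 by rewrite gt_eqF.
set x := ln N%:R / L; set y := ln N.+1%:R / L; rewrite -/x in IHN.
have x0 : 0 <= x by rewrite divr_ge0 ?ln_nat_ge0// ltW.
have xy : x <= y by rewrite ler_pM2r ?invr_gt0.
have y2 : y <= 2 by rewrite ler_pdivrMr.
have ex : ln N%:R = L * x by rewrite /x mulrC divfK.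
have ey : ln N.+1%:R = L * y by rewrite /y mulrC divfK.
rewrite big_mkcond big_nat_recr/= -?big_mkcond; last by lia.
have -> : (if prime N.+1 then ln N.+1%:R / N.+1%:R * phi (ln N.+1%:R / L) else 0) =
    (mertens R N.+1 - mertens R N) * phi y.
  by rewrite mertensS addrC addKr -/y; case: ifP => //; rewrite mul0r.
set I := fun s => (\int[mu]_(t in `[-1, s]) phi t)%R.
rewrite -/(I x) -/(I 0) -/(I y) in IHN *.
set S := \sum_(2 <= n < N.+1 | prime n) _ in IHN *.
(* The new error is the old one, minus [L] times the rectangle error on [[x, y]], minus the Abel
   summation term. *)
rewrite (_ : _ - _ - _ = (S - L * (I x - I 0) - (mertens R N - ln N%:R) * phi x)
  - L * (I y - I x - (y - x) * phi y) - (mertens R N - ln N%:R) * (phi y - phi x)); last first.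
  by rewrite ex ey; ring.
apply: (le_trans (ler_normB _ _)); apply: (le_trans (lerD (ler_normB _ _) (lexx _))).
(* Of the factor [5], one unit pays for the rectangle, as [L * (y - x) <= 1 / N <= 1], and four pay
   for the bounded Mertens error. *)
have -> : 5 * K * y = 5 * K * x + K * (y - x) + 4 * (K * (y - x)) by ring.
apply: lerD; first (apply: lerD; first exact: IHN).
- rewrite normrM (gtr0_norm L0).
  have := @riemann_rect phi (-1) x y K cphi _ xy _.
  move/(_ (lt_le_trans (ltrN10 _) x0)) => h.
  apply: (le_trans (ler_wpM2l (ltW L0) (h _))).
    move=> z /andP[xz zy]; apply: lip; rewrite ?y2 ?(le_trans zy y2) ?andbT.
      exact: le_trans xz.
    exact: le_trans xy.
  rewrite expr2 mulrCA ler_wpM2l// mulrA ler_piMl ?subr_ge0//.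
  rewrite mulrBr -ex -ey (le_trans (lnS_le R N0))// invf_le1 ?ltr0n// ler1n.
  by [].
- rewrite normrM ler_pM ?mertens_err//.
  rewrite -[y - x]ger0_norm ?subr_ge0// lip//; apply/andP; split => //.
  + exact: le_trans xy.
  + exact: le_trans y2.
Qed.

End PrimeRiemannSums.

(** * Folding the variance integral onto the positive half-line *)

Section SigmaIntegral.
Variable R : realType.
Let mu := @lebesgue_measure R.

(** Evenness doubles the integral over [u >= 0]; there the minimum is [u] up to [1], and past [1]
    the factor [g] already vanishes, so the upper limit can be any [x >= 1]. *)
Lemma sigma_half (g : R -> R) (c x : R) : continuous g -> (forall u, g (- u) = g u) ->
  c < 1 -> (forall u, c < `|u| -> g u = 0) -> 1 <= x ->
  intR (fun u => Num.min `|u| 1 * g u ^+ 2) =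
  2 * ((\int[mu]_(t in `[-1, x]) (t * g t ^+ 2))%R - (\int[mu]_(t in `[-1, 0%R]) (t * g t ^+ 2))%R).
Proof.
move=> cg eg c1 g0 x1.
pose phi t := t * g t ^+ 2; pose psi u : R := Num.min `|u| 1 * g u ^+ 2.
have csq : continuous (fun t => g t ^+ 2) by move=> t; apply: cvgM; exact: cg.
have cphi : continuous phi by move=> t; apply: cvgM; [exact: cvg_id|exact: csq].
have cpsi : continuous psi.
  move=> t; apply: cvgM; last exact: csq.
  by apply: continuous_min; [exact: norm_continuous|exact: cst_continuous].
have psi0 u : 0 <= psi u by rewrite mulr_ge0 ?sqr_ge0// le_min normr_ge0 ler01.
have psie : psi =1 psi \o -%R by move=> u; rewrite /psi /= normrN eg.
rewrite Rintegral_itvB ?bnd_simp ?lerN10 ?(le_trans ler01 x1)//; last exact: integrable_itv_continuous.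
rewrite /intR /Rintegral (ge0_symfun_integralT psi0 cpsi psie).
rewrite (_ : (\int[mu]_(u in [set u : R | (0 <= u)%R]) (psi u)%:E)%E =
    (\int[mu]_(t in `]0%R, x]) (phi t)%:E)%E); last first.
  rewrite integral_mkcond [RHS]integral_mkcond; apply: eq_integral => u _.
  rewrite /patch/=; case: ifPn; case: ifPn => //.
  - rewrite !inE/= in_itv/= => /andP[u0 ux] _; congr EFin; rewrite /psi /phi.
    rewrite (gtr0_norm u0); case: (leP u 1) => // u1.
    by rewrite g0 ?expr0n ?mulr0// gtr0_norm// (lt_trans c1).
  - rewrite notin_setE/= in_itv/= => /negP; rewrite negb_and -leNgt -ltNge inE /=.
    move=> /orP[u0 u0'|xu u0]; rewrite /psi.
      have -> : u = 0 by apply/eqP; rewrite eq_le u0.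
      by rewrite normr0 (min_idPl _) ?mul0r.
    by rewrite g0 ?expr0n ?mulr0// ger0_norm// (lt_trans c1)// (le_lt_trans x1).
  - by rewrite inE/= in_itv/= notin_setE/= => /andP[u0 _] /negP; rewrite ltW.
rewrite fineM//; apply: integrable_fin_num => //.
apply: integrableS (integrable_itv_continuous 0 x cphi) => //.
exact: subset_itv_oc_cc.
Qed.

End SigmaIntegral.

(** * Sums over prime powers *)

Section PrimePowers.
Variable R : realType.
Implicit Types (p k n N : nat).

Lemma vonMangoldt_pfactor p k : prime p -> (0 < k)%N ->
  vonMangoldt R (p ^ k) = ln p%:R.
Proof.
move=> pp; case: k => // k _; rewrite /vonMangoldt pdiv_pfactor// primesX// primes_prime//.
have -> // : (1 < p ^ k.+1)%N by rewrite -(exp1n k.+1) ltn_exp2r// prime_gt1.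
Qed.

Lemma vonMangoldt_neq0 n : vonMangoldt R n != 0 ->
  exists p k, [/\ prime p, (0 < k)%N & n = (p ^ k)%N].
Proof.
rewrite /vonMangoldt; case: ifP => [/andP[n1 sn]|]; last by rewrite eqxx.
move=> _; have [p pn] : exists p, primes n = [:: p].
  by case: (primes n) sn => [//|p [|//]] _; exists p.
have pp : prime p by have := mem_primes p n; rewrite pn inE eqxx => /esym/andP[].
have /p_natP[k nk] : p.-nat n by rewrite /pnat pn /= inE eqxx ltnW.
by exists p, k; split => //; case: k nk n1 => // ->.
Qed.

Lemma eq_pfactor p q k l : prime p -> prime q -> (0 < k)%N -> (0 < l)%N ->
  (p ^ k == q ^ l)%N = (p == q) && (k == l).
Proof.
move=> pp pq; case: k l => // k [//|l] _ _; apply/eqP/andP => [e|[/eqP -> /eqP ->]//].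
have epq : p = q by have := congr1 pdiv e; rewrite !pdiv_pfactor.
split; first exact/eqP.
by rewrite -(pfactorK k.+1 pp) e epq pfactorK.
Qed.

(** The range [k < N] loses nothing, as [k < p ^ k], and the pairs with [p ^ k >= N] contribute [0]
    by the hypothesis on [h]. *)
Lemma sum_vonMangoldt (h : nat -> R) N : (forall n, (N <= n)%N -> h n = 0) ->
  \sum_(2 <= n < N) vonMangoldt R n * h n =
  \sum_(0 <= p < N | prime p) \sum_(1 <= k < N) ln p%:R * h (p ^ k)%N.
Proof.
move=> hN.
have inner p k : prime p -> (0 < k)%N -> ln p%:R * h (p ^ k)%N =
    \sum_(2 <= n < N | n == (p ^ k)%N) vonMangoldt R n * h n.
  move=> pp k0; rewrite big_nat1_eq; case: ifP => [_|]; first by rewrite vonMangoldt_pfactor.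
  have -> /= : (1 < p ^ k)%N by rewrite -(exp1n k) ltn_exp2r// prime_gt1.
  by move=> /negbT; rewrite -leqNgt => /hN ->; rewrite mulr0.
transitivity (\sum_(0 <= p < N | prime p) \sum_(1 <= k < N)
    \sum_(2 <= n < N) (n == (p ^ k)%N)%:R * (vonMangoldt R n * h n)); last first.
  apply: eq_bigr => p pp; rewrite big_nat [RHS]big_nat; apply: eq_bigr => k /andP[k0 _].
  rewrite inner// [RHS]big_mkcond; apply: eq_bigr => n _.
  by case: eqP => _; rewrite ?mul1r ?mul0r.
under [RHS]eq_bigr do rewrite exchange_big /=.
rewrite exchange_big /= big_nat [RHS]big_nat; apply: eq_bigr => n /andP[n2 nN].
under [RHS]eq_bigr do rewrite -mulr_suml.
rewrite -mulr_suml; case: (eqVneq (vonMangoldt R n) 0) => [->|]; first by rewrite mul0r mulr0.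
move=> /vonMangoldt_neq0[q [l [pq l0 nql]]].
rewrite -[LHS]mul1r; congr (_ * _).
have qN : (q < N)%N.
  by apply: leq_ltn_trans nN; rewrite nql -[leqLHS]expn1 leq_pexp2l// prime_gt0.
have lN : (l < N)%N.
  by apply: leq_ltn_trans nN; rewrite nql ltnW// ltn_expl// prime_gt1.
transitivity (\sum_(0 <= p < N | p == q) 1 : R); first by rewrite big_nat1_eq qN.
rewrite big_mkcond [RHS]big_mkcond; apply: eq_bigr => p _.
case: ifPn => pq'; last first.
  case: ifPn => // pp; rewrite big_nat big1// => k /andP[k0 _].
  by rewrite nql eq_pfactor// eq_sym (negbTE pq').
rewrite (eqP pq') pq; transitivity (\sum_(1 <= k < N | k == l) 1 : R).
  by rewrite big_nat1_eq l0 lN.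
rewrite big_mkcond big_nat [RHS]big_nat; apply: eq_bigr => k /andP[k0 _].
by rewrite nql eq_pfactor// eqxx eq_sym; case: eqP.
Qed.

(** The ratio [3 / 4] exceeds [1 / sqrt 2], hence covers [1 / sqrt p] for every prime, and
    [4 = 1 / (1 - 3 / 4)]. *)
Lemma geometric_tail_le (x : R) m N : 0 <= x <= 3 / 4 ->
  \sum_(m <= k < N) x ^+ k <= 4 * x ^+ m.
Proof.
move=> /andP[x0 x34]; case: (leqP N m) => [Nm|mN].
  by rewrite big_geq// mulr_ge0// exprn_ge0.
rewrite -{1}[m]add0n big_addn big_mkord.
under eq_bigr do rewrite exprD; rewrite -mulr_suml ler_wpM2r ?exprn_ge0//.
elim: (N - m)%N => [|d IHd]; first by rewrite big_ord0.
rewrite big_ord_recl expr0; under eq_bigr do rewrite exprS.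
by rewrite -mulr_sumr; move: IHd; set s := \sum_(i < d) _; nra.
Qed.

Lemma sqrtrX (x : R) n : 0 <= x -> Num.sqrt (x ^+ n) = Num.sqrt x ^+ n.
Proof.
by move=> x0; elim: n => [|n IHn]; rewrite ?expr0 ?sqrtr1// !exprS sqrtrM ?IHn.
Qed.

Lemma invsqrt_prime_le p : prime p -> 0 <= (Num.sqrt p%:R : R)^-1 <= 3 / 4.
Proof.
move=> pp; rewrite invr_ge0 sqrtr_ge0/= -[leRHS]invrK lef_pV2 ?posrE; last 2 first.
- by rewrite sqrtr_gt0 ltr0n prime_gt0.
- by rewrite invr_gt0 divr_gt0.
rewrite -(@ler_pXn2r _ 2) ?nnegrE ?sqrtr_ge0 ?invr_ge0 ?divr_ge0// sqr_sqrtr//.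
apply: (@le_trans _ _ 2); last by rewrite ler_nat prime_gt1.
by rewrite invf_div; lra.
Qed.

Lemma ln_le_sqrt (x : R) : 0 < x -> ln x <= 2 * Num.sqrt x.
Proof.
move=> x0; have s0 : 0 < Num.sqrt x by rewrite sqrtr_gt0.
rewrite -[X in ln X](sqr_sqrtr (ltW x0)) lnXn// mulr_natl.
by rewrite lerMn2r /= ltW// ln_sublinear.
Qed.

End PrimePowers.

(** * Moments of the oscillatory sum *)

Section OscillatoryMoments.
Variable R : realType.
Variable w : R -> R.
Hypotheses (w0 : forall x, 0 <= w x) (iw : Lint w) (w1 : intR w = 1).
Variables (g : R -> R) (c F : R).
Hypotheses (c0 : 0 <= c) (c1 : c < 1) (g0 : forall u, c < `|u| -> g u = 0).
Hypotheses (F0 : 0 <= F) (gF : forall u, `|g u| <= F).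
Variables (T H L : R) (N m : nat).
Hypotheses (L1 : 1 <= L) (LF : 16 * F <= L) (m2 : (2 <= m)%N).
Hypotheses (N1 : (0 < N)%N) (NL : L <= ln N%:R <= 2 * L).
(** For [L = ln T] this is [T ^ c]; by [g0], prime powers beyond it have coefficient [0]. *)
Let K := expR (c * L).
Hypothesis res : resolved w T H (K ^+ m).
Implicit Types (p k i j : nat) (t : R).

Let L0 : 0 < L. Proof. exact: lt_le_trans L1. Qed.
Let K1 : 1 <= K.
Proof. by rewrite -expR0 ler_expR mulr_ge0// ltW. Qed.

Definition oscfreq p k : R := ln (p ^ k)%N%:R.
Definition osccoef p k : R :=
  - 2 * L^-1 * ln p%:R / Num.sqrt (p ^ k)%N%:R * g (oscfreq p k / L).
Definition oscterm p k t := osccoef p k * cos (oscfreq p k * t).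
(** The block [Y_p] of all powers of one prime, set to [0] at non-primes so that the blocks can be
    indexed by every natural number below [N.+1]. *)
Definition osc p t : R := if prime p then \sum_(1 <= k < N.+1) oscterm p k t else 0.
Definition oscsum j t : R := \sum_(0 <= p < j) osc p t.

Lemma oscterm_tpoly (nu : nat_pred) p k : (0 < k)%N -> prime p -> p \in nu ->
  tpoly (logfreq nu K) (oscterm p k).
Proof.
move=> k0 pp pnu; have pk0 : 0 < (p ^ k)%N%:R :> R by rewrite ltr0n expn_gt0 prime_gt0.
case: (leP (oscfreq p k / L) c) => h.
  apply: tpoly_cos; exists (p ^ k)%N, 1%N; split => //.
  - by rewrite pnatX pnatE// pnu.
  - by rewrite muln1 -[leLHS]lnK ?posrE// ler_expR -ler_pdivrMr.
  - by rewrite ln1 subr0.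
rewrite (_ : oscterm p k = fun=> 0); first exact: tpoly0.
apply/funext => t; rewrite /oscterm /osccoef g0 ?mulr0 ?mul0r// (lt_le_trans h)//.
exact: ler_norm.
Qed.

Lemma osc_tpoly (nu : nat_pred) p : p \in nu -> tpoly (logfreq nu K) (osc p).
Proof.
move=> pnu; case: (boolP (prime p)) => pp; last first.
  by rewrite (_ : osc p = fun=> 0); [exact: tpoly0|apply/funext => t; rewrite /osc (negbTE pp)].
rewrite (_ : osc p = fun t => \sum_(1 <= k < N.+1 | (0 < k)%N) oscterm p k t).
  by apply: tpoly_sum => k k0; exact: oscterm_tpoly.
apply/funext => t; rewrite /osc pp big_nat_cond [RHS]big_nat_cond.
by apply: eq_bigl => k; case: (ltnP 0 k); rewrite ?andbF ?andbT.
Qed.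

Lemma oscsum_tpoly (nu : nat_pred) j : (forall p, (p < j)%N -> p \in nu) ->
  tpoly (logfreq nu K) (oscsum j).
Proof.
move=> jnu; rewrite (_ : oscsum j = fun t => \sum_(0 <= p < j | (p < j)%N) osc p t).
  by apply: tpoly_sum => p /jnu; exact: osc_tpoly.
apply/funext => t; rewrite /oscsum big_nat_cond [RHS]big_nat_cond.
by apply: eq_bigl => p; rewrite leq0n /= andbT andbb.
Qed.

Lemma resolvedW k : (k <= m)%N -> resolved w T H (K ^+ k).
Proof.
move=> km l lk; apply: res; apply: logfreqW lk => //.
exact: ler_weXn2l.
Qed.

Lemma tavg_oscterm p k : (0 < k)%N -> prime p -> tavg w T H (oscterm p k) = 0.
Proof.
move=> k0 pp.
have [s [sK se]] := oscterm_tpoly (nu := predT) k0 pp isT.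
have lp : 0 < oscfreq p k.
  by rewrite ln_gt0// ltr1n -(exp1n k) ltn_exp2r// prime_gt1.
have tE : tavg w T H (oscterm p k) = osccoef p k * tavg w T H (fun t => cos (oscfreq p k * t)).
  have := @tavg_sum R w iw T H nat [:: k] predT (osccoef p) (fun k t => cos (oscfreq p k * t)).
  rewrite big_seq1 => <-; last by move=> i; exact: bcont_cos.
  by congr tavg; apply/funext => t; rewrite big_seq1.
rewrite tE; case: (leP (oscfreq p k / L) c) => h; last first.
  by rewrite /osccoef g0 ?mulr0 ?mul0r// (lt_le_trans h)// ler_norm.
rewrite (resolvedW (k := 1)) ?mulr0 ?gt_eqF//; first exact: leq_trans m2.
exists (p ^ k)%N, 1%N; split => //.
- by rewrite pnatX pnatE.
- rewrite muln1 expr1 -[leLHS]lnK ?posrE ?ler_expR -?ler_pdivrMr//.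
  by rewrite ltr0n expn_gt0 prime_gt0.
- by rewrite ln1 subr0.
Qed.

Lemma tavg_osc p : tavg w T H (osc p) = 0.
Proof.
have z0 : tavg w T H (fun=> 0 : R) = 0.
  by rewrite /tavg /intR; under eq_Rintegral do rewrite mul0r; rewrite /Rintegral integral0.
case: (boolP (prime p)) => pp; last first.
  by rewrite -[RHS]z0; congr tavg; apply/funext => t; rewrite /osc (negbTE pp).
have bt k : bcont (oscterm p k) by apply: bcontZ; exact: bcont_cos.
have -> : osc p = fun t => \sum_(1 <= k < N.+1) 1 * oscterm p k t.
  by apply/funext => t; rewrite /osc pp; apply: eq_bigr => k _; rewrite mul1r.
rewrite tavg_sum// big_nat big1// => k /andP[k0 _].
by rewrite tavg_oscterm// mulr0.
Qed.

Lemma osccoef_le p k : prime p ->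
  `|osccoef p k| <= 2 * F / L * ln p%:R * (Num.sqrt p%:R)^-1 ^+ k.
Proof.
move=> pp; rewrite /osccoef natrX sqrtrX// -exprVn.
have x0 : 0 <= (Num.sqrt p%:R)^-1 ^+ k :> R by rewrite exprn_ge0// invr_ge0 sqrtr_ge0.
rewrite !normrM normrN normr_nat (ger0_norm x0) (ger0_norm (ln_nat_ge0 R p)).
rewrite (@ger0_norm _ L^-1) ?invr_ge0 ?(ltW L0)//.
move: (_ ^+ k) x0 => y y0.
rewrite -subr_ge0 (_ : _ - _ = 2 / L * ln p%:R * y * (F - `|g (oscfreq p k / L)|)); last by ring.
by rewrite !mulr_ge0 ?invr_ge0 ?(ltW L0) ?ln_nat_ge0 ?subr_ge0.
Qed.

Lemma oscterm_le p k t : prime p ->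
  `|oscterm p k t| <= 2 * F / L * ln p%:R * (Num.sqrt p%:R)^-1 ^+ k.
Proof.
move=> pp; rewrite /oscterm normrM -[leRHS]mulr1 ler_pM ?osccoef_le//.
by rewrite ler_norml cos_geN1 cos_le1.
Qed.

(** The geometric tail costs a factor [4]. The case [j = 1] gives [oscbound]; the case [j = 2] gains
    a further [1 / sqrt p] for the proper prime powers. *)
Lemma oscterm_tail_le p j t : prime p ->
  `|\sum_(j <= k < N.+1) oscterm p k t| <= 8 * F / L * ln p%:R * (Num.sqrt p%:R)^-1 ^+ j.
Proof.
move=> pp; apply: (le_trans (ler_norm_sum _ _ _)).
apply: (le_trans (ler_sum _ (fun k _ => oscterm_le k t pp))).
rewrite -mulr_sumr (_ : 8 * F / L * ln p%:R * _ =
  2 * F / L * ln p%:R * (4 * (Num.sqrt p%:R)^-1 ^+ j)); last by ring.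
rewrite ler_wpM2l ?geometric_tail_le ?invsqrt_prime_le//.
by rewrite !mulr_ge0 ?invr_ge0 ?(ltW L0) ?ln_nat_ge0.
Qed.

Definition oscbound p : R :=
  if prime p then 8 * F / L * ln p%:R * (Num.sqrt p%:R)^-1 else 0.

Lemma osc_le p t : `|osc p t| <= oscbound p.
Proof.
rewrite /osc /oscbound; case: ifP => pp; last by rewrite normr0.
by rewrite -[_^-1]expr1 oscterm_tail_le.
Qed.

Lemma ln_invsqrt_le p : prime p -> ln p%:R * (Num.sqrt p%:R)^-1 <= 2 :> R.
Proof.
move=> pp; rewrite ler_pdivrMr ?sqrtr_gt0 ?ltr0n ?prime_gt0//.
by rewrite ln_le_sqrt// ltr0n prime_gt0.
Qed.

Lemma oscbound_ge0 p : 0 <= oscbound p.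
Proof.
by rewrite /oscbound; case: ifP => // _; rewrite !mulr_ge0 ?invr_ge0 ?sqrtr_ge0 ?(ltW L0) ?ln_nat_ge0.
Qed.

Lemma oscbound_le p : oscbound p <= 16 * F / L.
Proof.
rewrite /oscbound; case: ifP => pp; last by rewrite !mulr_ge0 ?invr_ge0 ?(ltW L0).
rewrite -mulrA (_ : 16 * F / L = 8 * F / L * 2); last by ring.
by rewrite ler_wpM2l ?ln_invsqrt_le// !mulr_ge0 ?invr_ge0 ?(ltW L0).
Qed.

Definition oscmoment j k := tavg w T H (fun t => oscsum j t ^+ k).
Definition oscmoment1 j k := tavg w T H (fun t => osc j t ^+ k).

Lemma tavg1 : tavg w T H (fun=> 1) = 1.
Proof.
by rewrite -[RHS](tavg_cos0 w1 T H); congr tavg; apply/funext => t; rewrite mul0r cos0.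
Qed.

Lemma osc_moment_rec : moment_rec N.+1 m oscmoment oscmoment1 oscbound.
Proof.
split.
- case=> [|k]; rewrite /oscmoment.
    by under eq_fun do rewrite expr0; exact: tavg1.
  rewrite /tavg /intR; under eq_Rintegral do rewrite /oscsum big_geq// expr0n mul0r.
  by rewrite /Rintegral integral0.
- move=> j k jN km; rewrite /oscmoment /oscmoment1.
  rewrite (_ : (fun t => oscsum j.+1 t ^+ k) = fun t => (oscsum j t + osc j t) ^+ k); last first.
    by apply/funext => t; rewrite /oscsum big_nat_recr.
  (* The prime [j] is split off from the numbers below it through the complementary sets [q != j]
     and [q = j]. *)
  apply: (@tavg_binomial R w iw w1 T H [pred q : nat | q != j] K) => //.
  + exact: resolvedW.
  + by apply: oscsum_tpoly => p pj; rewrite inE /= neq_ltn pj.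
  + by apply: osc_tpoly; rewrite !inE /= eqxx.
- move=> j jN; split; rewrite /oscmoment1.
  + by under eq_fun do rewrite expr0; exact: tavg1.
  + by under eq_fun do rewrite expr1; exact: tavg_osc.
  + by apply: tavg_ge0 => // t; rewrite sqr_ge0.
- move=> j k jN; apply: (tavg_le w0 iw w1).
    apply: tpoly_bcont (tpolyX k (osc_tpoly (nu := predT) (p := j) isT)).
  move=> t; rewrite normrX lerXn2r ?nnegrE ?oscbound_ge0//; exact: osc_le.
- move=> j jN; rewrite oscbound_ge0/= (le_trans (oscbound_le j))//.
  by rewrite ler_pdivrMr// mul1r.
Qed.

Let sum_primes_le : \sum_(0 <= p < N.+1 | prime p) ln p%:R / p%:R <= 6 * L.
Proof.
apply: (le_trans (mertens_le R N1)); have /andP[_ NL2] := NL.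
have : ln 4 < 4 :> R by apply: ln_sublinear.
by move: L1; lra.
Qed.

(** In [(ln p) ^ 2 / p] one factor is bounded by [2 * L] and Mertens' theorem sums the rest to at
    most [6 * L]; [64 * 2 * 6 = 768]. *)
Lemma sum_oscbound2 : \sum_(p < N.+1) oscbound p ^+ 2 <= 768 * F ^+ 2.
Proof.
rewrite -(big_mkord xpredT (fun p => oscbound p ^+ 2)).
apply: (@le_trans _ _ (\sum_(0 <= p < N.+1 | prime p) 128 * F ^+ 2 / L * (ln p%:R / p%:R))).
  rewrite [leRHS]big_mkcond big_nat [leRHS]big_nat; apply: ler_sum => p /= pN.
  rewrite /oscbound; case: ifP => pp; last by rewrite expr0n.
  rewrite !exprMn !exprVn sqr_sqrtr//.
  have p0 : 0 < p%:R :> R by rewrite ltr0n prime_gt0.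
  have lpL : ln p%:R <= 2 * L.
    have /andP[_] := NL; apply: le_trans; rewrite ler_ln ?posrE ?ltr0n// ?ler_nat//.
    exact: prime_gt0.
  rewrite -subr_ge0 (_ : _ - _ = 64 * F ^+ 2 * L^-1 ^+ 2 * (ln p%:R / p%:R) * (2 * L - ln p%:R)).
    by rewrite !mulr_ge0 ?exprn_ge0 ?invr_ge0 ?(ltW L0) ?ln_nat_ge0 ?subr_ge0.
  by field; rewrite !gt_eqF.
rewrite -mulr_sumr (_ : 768 * F ^+ 2 = 128 * F ^+ 2 / L * (6 * L)).
  by rewrite ler_wpM2l ?sum_primes_le// !mulr_ge0 ?exprn_ge0 ?invr_ge0 ?(ltW L0).
by field; rewrite gt_eqF.
Qed.

Lemma sum_oscbound3 : \sum_(p < N.+1) oscbound p ^+ 3 <= 16 * F / L * (768 * F ^+ 2).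
Proof.
apply: (@le_trans _ _ (\sum_(p < N.+1) 16 * F / L * oscbound p ^+ 2)).
  by apply: ler_sum => p _; rewrite exprS ler_wpM2r ?exprn_ge0 ?oscbound_ge0 ?oscbound_le.
rewrite -mulr_sumr ler_wpM2l ?sum_oscbound2//.
by rewrite !mulr_ge0 ?invr_ge0 ?(ltW L0).
Qed.

(** The squared cosine contributes its mean [1 / 2]. Unless the coefficient is zero, the other
    frequency, [2 * l], has height [K ^ 2], which is resolved because [m >= 2]. *)
Lemma tavg_oscterm2 p : prime p ->
  tavg w T H (fun t => oscterm p 1 t ^+ 2) = osccoef p 1 ^+ 2 / 2.
Proof.
move=> pp; set l := oscfreq p 1.
have lp : 0 < l by rewrite /l ln_gt0// ltr1n expn1 prime_gt1.
pose fr (b : bool) : R := if b then 0 else 2 * l.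
have -> : (fun t => oscterm p 1 t ^+ 2) =
    fun t => \sum_(b <- [:: true; false]) osccoef p 1 ^+ 2 / 2 * cos (fr b * t).
  apply/funext => t; rewrite !big_cons big_nil /fr /oscterm -/l mul0r cos0 exprMn.
  have -> : 2 * l * t = l * t *+ 2 by rewrite mulr2n; ring.
  by rewrite cos_mulr2n; lra.
rewrite tavg_sum//; last by move=> b; exact: bcont_cos.
rewrite !big_cons big_nil /fr tavg_cos0//.
case: (leP (l / L) c) => h; last first.
  by rewrite /osccoef -/l g0 ?mulr0 ?expr0n ?mul0r ?addr0 ?mulr0// (lt_le_trans h)// ler_norm.
rewrite (resolvedW m2) ?mulr1 ?mulr0 ?addr0 ?gt_eqF ?mulr_gt0//.
have lf : logfreq predT K l.
  exists (p ^ 1)%N, 1%N; split => //.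
  - by rewrite pnatX pnatE.
  - rewrite muln1 -[leLHS]lnK ?posrE ?ler_expR -?ler_pdivrMr//.
    by rewrite ltr0n expn_gt0 prime_gt0.
  - by rewrite ln1 subr0.
by rewrite expr2 mulr_natl mulr2n; exact: logfreqD.
Qed.

(** The term [k = 1] gives the main part. The rest of the square is
    [tail * (2 * oscterm p 1 + tail)], where [tail] is at most [8 * F / L * (ln p / p)] and the
    other factor at most [24 * F / L]; [8 * 24 = 192]. *)
Lemma oscvar_main p : prime p ->
  `|oscmoment1 p 2 - 2 / L * (ln p%:R / p%:R * (ln p%:R / L * g (ln p%:R / L) ^+ 2))|
    <= 192 * F ^+ 2 / L ^+ 2 * (ln p%:R / p%:R).
Proof.
move=> pp; have p0 : 0 < p%:R :> R by rewrite ltr0n prime_gt0.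
set tail := fun t => \sum_(2 <= k < N.+1) oscterm p k t.
have oscE t : osc p t = oscterm p 1 t + tail t.
  by rewrite /osc pp big_ltn.
have bt : bcont (fun t => oscterm p 1 t ^+ 2).
  by apply: tpoly_bcont (tpolyX 2 (oscterm_tpoly (nu := predT) (isT : 0 < 1)%N pp isT)).
have bo : bcont (fun t => osc p t ^+ 2).
  exact: tpoly_bcont (tpolyX 2 (osc_tpoly (nu := predT) (p := p) isT)).
have bd : bcont (fun t => osc p t ^+ 2 + -1 * oscterm p 1 t ^+ 2).
  by apply: bcontD => //; exact: bcontZ.
have e : tavg w T H (fun t => osc p t ^+ 2 + -1 * oscterm p 1 t ^+ 2) =
    oscmoment1 p 2 - osccoef p 1 ^+ 2 / 2.
  rewrite -tavg_oscterm2// /oscmoment1.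
  have := @tavg_sum R w iw T H bool [:: true; false] predT (fun b => if b then 1 else -1)
    (fun b t => if b then osc p t ^+ 2 else oscterm p 1 t ^+ 2).
  rewrite !big_cons big_nil /= addr0 mul1r mulN1r => <-; last by case.
  by congr tavg; apply/funext => t; rewrite !big_cons big_nil addr0 mul1r.
have main : 2 / L * (ln p%:R / p%:R * (ln p%:R / L * g (ln p%:R / L) ^+ 2)) =
    osccoef p 1 ^+ 2 / 2.
  rewrite /osccoef /oscfreq expn1 !exprMn !exprVn sqr_sqrtr//.
  by field; rewrite !gt_eqF.
rewrite main -e; apply: (tavg_le w0 iw w1 _ _ bd) => t.
set x := (Num.sqrt p%:R)^-1 : R.
have x0 : 0 <= x by rewrite invr_ge0 sqrtr_ge0.
have x1 : x <= 1 by have /andP[_] := invsqrt_prime_le R pp; rewrite -/x; lra.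
have xx : x * x = p%:R^-1 by rewrite -expr2 /x exprVn sqr_sqrtr.
have hz := oscterm_le 1 t pp; have hr := oscterm_tail_le 2 t pp.
rewrite -/x expr1 in hz; rewrite -/(tail t) -/x expr2 in hr.
have lx : ln p%:R * x <= 2 := ln_invsqrt_le pp.
have l0 : 0 <= ln p%:R :> R := ln_nat_ge0 R p.
rewrite oscE (_ : _ + _ = tail t * (2 * oscterm p 1 t + tail t)); last by ring.
rewrite normrM (_ : 192 * F ^+ 2 / L ^+ 2 * (ln p%:R / p%:R) =
  8 * F / L * ln p%:R * (x * x) * (24 * F / L)); last first.
  by rewrite xx; field; rewrite !gt_eqF.
apply: ler_pM => //; apply: (le_trans (ler_normD _ _)); rewrite normrM normr_nat.
have FL : 0 <= F / L by rewrite divr_ge0// ltW.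
have h1 : F / L * (ln p%:R * x) <= F / L * 2 by rewrite ler_wpM2l.
have h2 : F / L * (ln p%:R * x * x) <= F / L * 2.
  by rewrite ler_wpM2l// (le_trans _ lx)// ler_piMr// mulr_ge0.
move: hz hr; rewrite (_ : 2 * F / L * _ * x = 2 * (F / L * (ln p%:R * x))); last by ring.
rewrite (_ : 8 * F / L * _ * (x * x) = 8 * (F / L * (ln p%:R * x * x))); last by ring.
rewrite (_ : 24 * F / L = 24 * (F / L)); last by ring.
by lra.
Qed.

Lemma sum_oscvar :
  `|\sum_(p < N.+1) oscmoment1 p 2 - 2 / L * \sum_(2 <= p < N.+1 | prime p)
     ln p%:R / p%:R * (ln p%:R / L * g (ln p%:R / L) ^+ 2)| <= 1152 * F ^+ 2 / L.
Proof.
have z p : ~~ prime p -> oscmoment1 p 2 = 0.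
  move=> pp; rewrite /oscmoment1 /tavg /intR.
  under eq_Rintegral do rewrite /osc (negbTE pp) expr0n mul0r.
  by rewrite /Rintegral integral0.
have -> : \sum_(2 <= p < N.+1 | prime p) ln p%:R / p%:R * (ln p%:R / L * g (ln p%:R / L) ^+ 2) =
  \sum_(0 <= p < N.+1 | prime p) ln p%:R / p%:R * (ln p%:R / L * g (ln p%:R / L) ^+ 2).
  rewrite [RHS](big_cat_nat (n := 2))//=.
  rewrite [X in _ = X + _](_ : _ = 0) ?add0r// big_nat_cond big1//.
  by case=> [|[|i]] /andP[].
rewrite -(big_mkord xpredT (fun p => oscmoment1 p 2)) mulr_sumr.
rewrite [X in X - _](_ : _ = \sum_(0 <= p < N.+1 | prime p) oscmoment1 p 2); last first.
  by rewrite [RHS]big_mkcond; apply: eq_bigr => p _; case: ifPn => // /z.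
rewrite -sumrB; apply: (le_trans (ler_norm_sum _ _ _)).
apply: (le_trans (ler_sum _ (fun p pp => oscvar_main pp))).
rewrite -mulr_sumr (_ : 1152 * F ^+ 2 / L = 192 * F ^+ 2 / L ^+ 2 * (6 * L)).
  by rewrite ler_wpM2l ?sum_primes_le// !mulr_ge0 ?exprn_ge0 ?invr_ge0 ?exprn_ge0 ?(ltW L0).
by field; rewrite gt_eqF.
Qed.

End OscillatoryMoments.

(** * Asymptotics *)

Section Assembly.
Variable R : realType.
Implicit Types (f w g : R -> R) (a c F K L M T t : R).

(** For [n > N >= T] the ratio [ln n / ln T] is at least [1 > c], so the partial sums are eventually
    constant; the resulting finite sum is regrouped by primes. *)
Lemma Nosc_oscsum f c T N t : c < 1 -> (forall u, c < `|u| -> ft_re f u = 0) ->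
  1 < T -> T <= N%:R -> Nosc f T t = oscsum (ft_re f) (ln T) N N.+1 t.
Proof.
move=> c1 f0 T1 TN; set g := ft_re f; set L := ln T.
have L0 : 0 < L by rewrite ln_gt0.
pose h n := (Num.sqrt n%:R)^-1 * g (ln n%:R / L) * (2 * cos (t * ln n%:R)).
have h0 n : (N < n)%N -> h n = 0.
  move=> Nn; have Tn : T < n%:R by rewrite (le_lt_trans TN)// ltr_nat.
  have T0 : 0 < T by apply: lt_trans T1.
  have n0 : 0 < n%:R :> R by apply: lt_trans Tn.
  rewrite /h /g f0 ?mulr0 ?mul0r// (lt_le_trans c1)// (le_trans _ (ler_norm _))//.
  by rewrite ler_pdivlMr// mul1r ler_ln ?posrE// ltW.
rewrite /Nosc -/L (_ : limn _ = \sum_(2 <= n < N.+1) vonMangoldt R n * h n); last first.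
  apply: lim_near_cst => //; exists N.+3 => // M /= NM.
  rewrite (big_cat_nat (n := N.+1)) /=; last 2 first.
  - by rewrite ltnS -(ltr_nat R) (lt_le_trans _ TN)// (lt_trans _ T1).
  - by rewrite (leq_trans _ NM)// -addn2 leq_addr.
  rewrite [X in _ + X]big_nat [X in _ + X]big1 ?addr0.
    by apply: eq_bigr => n _; rewrite /h -/g -/L; ring.
  move=> n /andP[Nn _]; have := h0 n Nn; rewrite /h -/g => h0n.
  by rewrite -!mulrA [_ * (g _ * _)]mulrA h0n mulr0.
rewrite sum_vonMangoldt// mulr_sumr /oscsum big_mkcond; apply: eq_bigr => p _.
rewrite /osc; case: ifP => // pp; rewrite mulr_sumr; apply: eq_bigr => k _.
by rewrite /oscterm /osccoef /oscfreq /h -/g [t * _]mulrC; ring.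
Qed.

(** With [d = a - c * m / 2], a nonzero frequency times the window length is at least
    [exp (d * L) / 2], which exceeds [2 * pi * |M|] by [exp x >= 1 + x]; the Fourier transform of
    [w] vanishes there. *)
Lemma resolved_large w a c M T L m : Lint w ->
  (forall u, M < `|u| -> ft_re w u = 0 /\ ft_im w u = 0) -> 0 < a - c * m%:R / 2 -> 4 * pi * `|M| <= (a - c * m%:R / 2) * L ->
  resolved w T (expR (a * L)) (expR (c * L) ^+ m).
Proof.
move=> iw wM d0 dL l lf l0; set d := a - c * m%:R / 2 in d0 dL.
have := logfreq_gap lf l0.
have -> : Num.sqrt (expR (c * L) ^+ m) = expR (c * m%:R / 2 * L).
  rewrite -expRM_natr (_ : c * L * _ = c * m%:R / 2 * L * 2%:R); last by field.
  by rewrite expRM_natr sqrtr_sqr ger0_norm ?expR_ge0.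
move=> gap; have p0 : 0 < pi :> R := pi_gt0 R.
have uM : M < `|l * expR (a * L) / (2 * pi)|.
  apply: (le_lt_trans (ler_norm M)).
  rewrite !normrM (ger0_norm (expR_ge0 _)) (@ger0_norm _ (2 * pi)^-1); last first.
    by rewrite invr_ge0 mulr_ge0// ltW.
  rewrite ltr_pdivlMr ?mulr_gt0//.
  apply: (@lt_le_trans _ _ ((2 * expR (c * m%:R / 2 * L))^-1 * expR (a * L))); last first.
    by rewrite ler_wpM2r ?expR_ge0.
  rewrite invfM -expRN -[ltRHS]mulrA -expRD (_ : _ + _ = d * L); last by rewrite /d; ring.
  by have := expR_ge1Dx (d * L); move: dL; rewrite [4 * pi]mulrC; move: (expR _) => e; lra.
have [re0 im0] := wM _ uM.
exact: tavg_cos.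
Qed.

(** The interval [[0, 2]] holds every argument [ln n / L] with [1 <= n <= N] of the Riemann sum, as
    [ln N <= 2 * L]. *)
Lemma lipschitz_mul_sqr g F Kg : 0 <= F -> 0 <= Kg -> (forall u, `|g u| <= F) ->
  (forall x y, 0 <= x <= 2 -> 0 <= y <= 2 -> `|g x - g y| <= Kg * `|x - y|) ->
  forall x y, 0 <= x <= 2 -> 0 <= y <= 2 ->
    `|x * g x ^+ 2 - y * g y ^+ 2| <= (F ^+ 2 + 4 * F * Kg) * `|x - y|.
Proof.
move=> F0 Kg0 gF glip x y x02 y02.
rewrite (_ : _ - _ = g x ^+ 2 * (x - y) + y * ((g x - g y) * (g x + g y))); last by ring.
rewrite [leRHS]mulrDl; apply: (le_trans (ler_normD _ _)); apply: lerD; rewrite !normrM.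
  by rewrite ler_wpM2r// expr2 ler_pM.
have /andP[y0 y2] := y02; rewrite ger0_norm//.
have h1 := glip x y x02 y02.
have h2 : `|g x + g y| <= 2 * F.
  by apply: (le_trans (ler_normD _ _)); have := gF x; have := gF y; lra.
have h3 : `|g x - g y| * `|g x + g y| <= Kg * `|x - y| * (2 * F) by apply: ler_pM.
rewrite (_ : 4 * F * Kg * _ = 2 * (Kg * `|x - y| * (2 * F))); last by ring.
by apply: ler_pM => //; rewrite mulr_ge0.
Qed.

End Assembly.

(** * Choice of constants and comparison of the total variance with [sigma2 f] *)

Theorem theorem7 (R : realType) (a alpha : R) (f w : R -> R) :
  0 < a -> a <= 1 -> 0 < alpha ->
  (* f real-valued, even, integrable; \hat f in C_c^infty with supp in (-alpha, alpha) *)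
  (forall x, f (- x) = f x) -> Lint f ->
  smooth (ft_re f) ->
  (exists c, 0 <= c /\ c < alpha /\ forall u, c < `|u| -> ft_re f u = 0) ->
  (* w >= 0, int w = 1, \hat w compactly supported *)
  (forall x, 0 <= w x) -> Lint w -> intR w = 1 ->
  (exists M, forall u, M < `|u| -> ft_re w u = 0 /\ ft_im w u = 0) ->
  forall m : nat, (2 <= m)%N -> m%:R < 2 * a / alpha ->
  exists C : R, exists T0 : R, forall T : R, T0 <= T ->
    `| avg w (fun tau => Nosc f T tau ^+ m) T (T `^ a)
       - gauss_moment m (sigma2 f) | <= C / ln T.
Proof.
move=> a0 a1 al0 _ _ smf [c [c0 [cal g0]]] w0 iw w1 [M wM] m m2 ma.
set g := ft_re f in smf g0.
have {}ma : m%:R * alpha < 2 * a by rewrite -ltr_pdivlMr.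
have m2' : 2 <= m%:R :> R by rewrite ler_nat.
(* Here [m >= 2] enters: [2 * alpha <= m * alpha < 2 * a <= 2]. *)
have c1 : c < 1.
  have : 2 * alpha <= m%:R * alpha by rewrite ler_pM2r.
  by lra.
have d0 : 0 < a - c * m%:R / 2.
  have : c * m%:R <= m%:R * alpha by rewrite mulrC ler_wpM2l// ltW.
  by lra.
set d := a - c * m%:R / 2 in d0.
have eg u : g (- u) = g u.
  by rewrite /g /ft_re; congr intR; apply/funext => x; rewrite mulrN cosN.
have dg x : derivable g x 1 := smf 0%N x.
have cg : continuous g := derivable_continuous dg.
have cdg : continuous (g^`())%classic := derivable_continuous (smf 1%N).
have [F F0 gF] : exists2 F : R, 0 <= F & forall u, `|g u| <= F.
  have [F F0 hF] := continuous_bounded_itv (ltW (lt_trans (ltrN10 R) ltr01)) cg.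
  exists F => // u; case: (leP `|u| 1) => u1; first by apply: hF; rewrite -ler_norml.
  by rewrite g0 ?normr0// (lt_trans c1).
have [Kg Kg0 glip] := lipschitz_itv (ler0n R 2) dg cdg.
set K := F ^+ 2 + 4 * F * Kg.
have K0 : 0 <= K by rewrite addr_ge0 ?exprn_ge0// !mulr_ge0.
pose phi x := x * g x ^+ 2.
have lip := lipschitz_mul_sqr F0 Kg0 gF glip; rewrite -/K in lip.
have cphi : continuous phi.
  by move=> x; apply: cvgM; [exact: cvg_id|apply: cvgM; exact: cg].
set s2 := sigma2 f.
have [B0 B0E] : exists B0, B0 = 768 * F ^+ 2 by exists (768 * F ^+ 2).
have B00 : 0 <= B0 by rewrite B0E mulr_ge0 ?ler0n ?exprn_ge0.
have [C1 C10 hC1] := moment_rec_gauss m B00.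
(* A radius that contains both the variance of the finite sum, at most [B0], and [s2]. *)
have B10 : 0 <= B0 + `|s2| by rewrite addr_ge0.
have [C2 C20 hC2] := gauss_moment_lipschitz m B10.
(* The first summand is the cubic error of the moment comparison, the second the variance error
   passed through the Lipschitz bound. *)
exists (C1 * (16 * F * B0) + C2 * (1152 * F ^+ 2 + 20 * K)).
(* The three summands ensure in turn [L >= 1], bounds [oscbound] of size at most [1], and a window
   that resolves all frequencies of height [T ^ (c * m)]. *)
exists (expR (1 + 16 * F + 4 * pi * `|M| / d)) => T T0T.
have q0 : 0 <= 4 * pi * `|M| / d.
  by rewrite divr_ge0 ?(ltW d0)// mulr_ge0// mulr_ge0// pi_ge0.
have T2 : 2 <= T.
  by apply: (le_trans _ T0T); apply: (le_trans _ (expR_ge1Dx _)); lra.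
have Tgt0 : 0 < T by apply: lt_le_trans T2.
set L := ln T.
have LL : 1 + 16 * F + 4 * pi * `|M| / d <= L by rewrite -ler_expR lnK ?posrE.
have L1 : 1 <= L by lra.
have L0 : 0 < L by lra.
have LF : 16 * F <= L by lra.
have dL : 4 * pi * `|M| <= d * L.
  by rewrite [d * L]mulrC -ler_pdivrMr//; lra.
(* [N >= T] loses no term of the series, while [N <= T + 1 <= T ^ 2] gives [ln N <= 2 * L]. *)
pose N := (Num.truncn T).+1.
have TN : T <= N%:R by rewrite ltW// truncnS_gt.
have NT : N%:R <= T + 1.
  by rewrite /N -natr1 lerD2r truncn_le ltW.
have N1 : (0 < N)%N by [].
have NL : L <= ln N%:R <= 2 * L.
  rewrite ler_ln ?posrE ?ltr0n// TN/= mulr_natl -lnXn//.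
  by rewrite ler_ln ?posrE ?ltr0n ?exprn_gt0// (le_trans NT)// expr2; nra.
have hH : T `^ a = expR (a * L) by rewrite /powR gt_eqF.
have res : resolved w T (T `^ a) (expR (c * L) ^+ m) by rewrite hH; exact: (resolved_large T iw wM d0 dL).
have NE : (fun tau => Nosc f T tau ^+ m) = fun tau => oscsum g L N N.+1 tau ^+ m.
  by apply/funext => t; rewrite (Nosc_oscsum t c1 g0 _ TN)// (lt_le_trans _ T2)// ltr1n.
have tp := oscsum_tpoly g0 N L1 (nu := predT) (j := N.+1) (fun _ _ => isT).
rewrite avg_tavg//; [|by rewrite hH expR_gt0|by rewrite NE; exact: tpoly_bcont (tpolyX m tp)].
rewrite NE -/(oscmoment w g T (T `^ a) L N N.+1 m).
have rec := osc_moment_rec w0 iw w1 c0 g0 F0 gF N L1 LF m2 res.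
have sb2 := sum_oscbound2 F0 L1 N1 NL.
have sb3 := sum_oscbound3 F0 L1 N1 NL.
rewrite -B0E in sb2 sb3.
have hM := hC1 _ _ _ _ rec sb2 m N.+1 (leqnn _) (leqnn _).
set V := \sum_(j < N.+1) _ in hM.
have VB : `|V| <= B0.
  apply: (le_trans (ler_norm_sum _ _ _)); apply: le_trans sb2; apply: ler_sum => j _.
  by have [_ _ _ yb _] := rec; exact: yb.
have hV := sum_oscvar w0 iw w1 c0 g0 F0 gF L1 m2 N1 NL res.
have x1 : 1 <= ln N%:R / L by rewrite ler_pdivlMr// mul1r; have /andP[] := NL.
have x2 : ln N%:R / L <= 2 by rewrite ler_pdivrMr//; have /andP[] := NL.
have phi0 : phi 0 = 0 by rewrite /phi mul0r.
have hS := prime_riemann_sum cphi phi0 K0 L0 lip N1 (proj2 (andP NL)).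
(* The boundary term of the Abel summation disappears because [ln N / L >= 1 > c]. *)
have phix : phi (ln N%:R / L) = 0.
  by rewrite /phi g0 ?expr0n ?mulr0// ger0_norm ?(lt_le_trans c1)// (le_trans _ x1).
pose I := ((\int[@lebesgue_measure R]_(t in `[-1, ln N%:R / L]) phi t)
  - \int[@lebesgue_measure R]_(t in `[-1, 0%R]) phi t)%R.
have s2E : s2 = 2 * I := sigma_half cg eg c1 g0 x1.
rewrite phix mulr0 subr0 -/I in hS.
set S := \sum_(2 <= n < N.+1 | prime n) _ in hS.
rewrite -/V (_ : \sum_(2 <= p < N.+1 | prime p) _ = S)// in hV.
(* Two errors add: the higher prime powers in the variance, and the Riemann sum error
   [5 * K * (ln N / L) <= 10 * K] scaled by [2 / L]. *)
have hVs : `|V - s2| <= (1152 * F ^+ 2 + 20 * K) / L.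
  rewrite -(subrK (2 / L * S) V) -addrA [leRHS]mulrDl; apply: (le_trans (ler_normD _ _)).
  apply: lerD; first exact: hV.
  rewrite (_ : 2 / L * S - s2 = 2 / L * (S - L * I)); last first.
    by rewrite s2E; field; rewrite gt_eqF.
  rewrite normrM ger0_norm ?divr_ge0// ?(ltW L0)//.
  rewrite (_ : 20 * K / L = 2 / L * (10 * K)); last by ring.
  rewrite ler_wpM2l ?divr_ge0 ?(ltW L0)//; apply: (le_trans hS).
  rewrite (_ : 10 * K = 5 * K * 2); last by ring.
  by rewrite ler_wpM2l// mulr_ge0.
have hG : `|gauss_moment m V - gauss_moment m s2| <= C2 * ((1152 * F ^+ 2 + 20 * K) / L).
  apply: (le_trans (hC2 _ _ _ _)); last by rewrite ler_wpM2l.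
    by rewrite (le_trans VB)// lerDl.
  by rewrite lerDr.
have hM' := le_trans hM (ler_wpM2l C10 sb3).
rewrite -(subrK (gauss_moment m V) (oscmoment _ _ _ _ _ _ _ _)) -addrA.
apply: (le_trans (ler_normD _ _)); rewrite [leRHS]mulrDl; apply: lerD.
  by rewrite (_ : _ / L = C1 * (16 * F / L * B0))//; ring.
by rewrite -mulrA.
Qed.
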